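(* Let $n\ge 1$ and $w\in S_n$. The following two statements are equivalent. (1) $w$ is a 1432-avoiding permutation. (2) The double Grothendieck polynomial of $w$ satisfies $$\mathfrak{G}_{w}(\mathbf{x},\mathbf{y})=\sum_{T\in \mathrm{SVRT}(w,\mathbf{f}_0)}(-1)^{|T|-\ell(w)} \prod_{(i,j)\in D(w)}\ \prod_{t\in T(i,j)}\bigl(x_t\oplus y_{m_{ij}(w)+i-t}\bigr).$$
   Context: $S_n$ is the set of permutations $w=w_1w_2\cdots w_n$ of $\{1,\ldots,n\}$. $w$ is 1432-avoiding if there are no indices $i_1<i_2<i_3<i_4$ with $w_{i_1}<w_{i_4}<w_{i_3}<w_{i_2}$. The length $\ell(w)$ is the number of inversions, i.e. pairs $i<j$ with $w_i>w_j$. Rothe diagram: in an $n\times n$ grid, $(i,j)$ denotes the square in row $i$ (rows numbered from top to bottom) and column $j$ (columns numbered from left to right). $D(w)$ is the set of squares $(i,j)$ such that $w_i>j$ and the value $j$ appears in $w$ at a position greater than $i$ (i.e. $w_h=j$ for some $h>i$). One has $|D(w)|=\ell(w)$. For $(i,j)\in D(w)$ put $m_{ij}(w)=|\{(i,k)\in D(w) : k\le j\}|$. Set-valued Rothe tableaux: for finite nonempty sets $A,B$ of positive integers, $A<B$ means $\max A<\min B$ and $A\le B$ means $\max A\le \min B$. A set-valued Rothe tableau $T$ of shape $D(w)$ assigns to each square $(i,j)\in D(w)$ a finite nonempty set $T(i,j)$ of positive integers such that rows are weakly decreasing from left to right ($T(i,k)\le T(i,j)$ whenever $(i,j),(i,k)\in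 D(w)$, $j<k$) and columns are strictly increasing from top to bottom ($T(i,j)<T(h,j)$ whenever $(i,j),(h,j)\in D(w)$, $i<h$). It is flagged by $\mathbf{f}=(f_1,\ldots,f_n)$ if every integer in row $i$ is at most $f_i$. $\mathrm{SVRT}(w,\mathbf{f})$ is the set of set-valued Rothe tableaux of shape $D(w)$ flagged by $\mathbf{f}$; $\mathbf{f}_0=(1,2,\ldots,n)$. $|T|=\sum_{B\in D(w)}|T(B)|$. Notation: $x\oplus y=x+y-xy$. Double Grothendieck polynomials: $\mathbf{x}=(x_1,x_2,\ldots)$, $\mathbf{y}=(y_1,y_2,\ldots)$. Let $s_i$ be the transposition of $i$ and $i+1$; $ws_i$ is obtained from $w$ by swapping $w_i$ and $w_{i+1}$. Acting only on the $\mathbf{x}$-variables, $\partial_i f=\frac{f-s_if}{x_i-x_{i+1}}$, where $s_if$ interchanges $x_i$ and $x_{i+1}$ in $f$, and $\pi_i f=\partial_i((1-x_{i+1})f)$. For $w_0=n\,(n-1)\cdots 1$, $\mathfrak{G}_{w_0}(\mathbf{x},\mathbf{y})=\prod_{i+j\le n}(x_i+y_j-x_iy_j)$ (product over $i,j\ge 1$); for $w\ne w_0$, $\mathfrak{G}_w(\mathbf{x},\mathbf{y})=\pi_i\mathfrak{G}_{ws_i}(\mathbf{x},\mathbf{y})$ for any $i$ with $\ell(ws_i)=\ell(w)+1$ (independent of the choice of $i$). *)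

(* Defs.v *)
From mathcomp Require Import all_boot all_order all_algebra all_fingroup.
From mathcomp Require Import ring zify.
From mathcomp Require Import mpoly.

Set Implicit Arguments.
Unset Strict Implicit.
Unset Printing Implicit Defensive.

Import GRing.Theory.
Local Open Scope ring_scope.

(** Everything that is 1-based on paper and has type ['I_n] here (positions and
    values of a permutation, rows, columns, entries of tableaux, indices of the
    x-variables) is shifted by one: the ordinal [k] stands for the integer
    [k + 1].  Subscripts of the y-variables are natural numbers and are not
    shifted. *)

(** * Permutations *)

Definition perm_length n (w : 'S_n) : nat :=
  #|[set p : 'I_n * 'I_n | (p.1 < p.2)%N && (w p.2 < w p.1)%N]|.

Definition avoids1432 n (w : 'S_n) : Prop :=
  ~ exists i1 i2 i3 i4 : 'I_n,
      [/\ (i1 < i2)%N, (i2 < i3)%N & (i3 < i4)%N] /\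
      [/\ (w i1 < w i4)%N, (w i4 < w i3)%N & (w i3 < w i2)%N].

(** The transposition s_i.  [ordS] is the cyclic successor: [adj i] and the
    operators below are meaningful only when [i.+1 < n]. *)
Definition adj n (i : 'I_n) : 'S_n := tperm i (ordS i).

(** [(s * t)%g] applies [s] first, so this exchanges the values of [w] at the
    positions [i] and [i + 1]. *)
Definition swap_at n (w : 'S_n) (i : 'I_n) : 'S_n := (adj i * w)%g.

Definition longest n : 'S_n := perm (@rev_ord_inj n).

(** * Rothe diagrams *)

Definition rothe n (w : 'S_n) : {set 'I_n * 'I_n} :=
  [set b : 'I_n * 'I_n |
     (b.2 < w b.1)%N && [exists h : 'I_n, (b.1 < h)%N && (w h == b.2)]].

Definition rothe_m n (w : 'S_n) (b : 'I_n * 'I_n) : nat :=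
  #|[set k : 'I_n | ((b.1, k) \in rothe w) && (k <= b.2)%N]|.

(** * Set-valued Rothe tableaux *)

Definition set_max n (A : {set 'I_n}) : nat := \max_(a in A) a.
(* [n] bounds every element of ['I_n], hence is neutral for this minimum. *)
Definition set_min n (A : {set 'I_n}) : nat := \big[minn/n]_(a in A) a.

Definition set_lt n (A B : {set 'I_n}) : bool := (set_max A < set_min B)%N.
Definition set_le n (A B : {set 'I_n}) : bool := (set_max A <= set_min B)%N.

(** A filling of the [n] x [n] grid; it is empty exactly off the diagram, so that
    tableaux of shape [rothe w] are represented uniquely. *)
Definition filling n := {ffun 'I_n * 'I_n -> {set 'I_n}}.

Definition is_rothe_tableau n (w : 'S_n) (T : filling n) : bool :=
  [&& [forall b, (T b != set0) == (b \in rothe w)],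
      [forall i : 'I_n, forall j : 'I_n, forall k : 'I_n,
         [&& (i, j) \in rothe w, (i, k) \in rothe w & (j < k)%N]
           ==> set_le (T (i, k)) (T (i, j))]
    & [forall i : 'I_n, forall h : 'I_n, forall j : 'I_n,
         [&& (i, j) \in rothe w, (h, j) \in rothe w & (i < h)%N]
           ==> set_lt (T (i, j)) (T (h, j))]].

Definition flagged n (f : 'I_n -> 'I_n) (T : filling n) : bool :=
  [forall b : 'I_n * 'I_n, forall t in T b, (t <= f b.1)%N].

Definition SVRT n (w : 'S_n) (f : 'I_n -> 'I_n) : {set filling n} :=
  [set T | is_rothe_tableau w T && flagged f T].

(** The flag (1, 2, ..., n). *)
Definition flag0 n : 'I_n -> 'I_n := id.

Definition tableau_size n (w : 'S_n) (T : filling n) : nat :=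
  (\sum_(b in rothe w) #|T b|)%N.

(** * Polynomials *)

(** Z[x_1, ..., x_n, y_1, ..., y_n]. *)
Definition xypoly n := {mpoly int[n + n]}.

Definition xvar n (i : 'I_n) : xypoly n := 'X_(lshift n i).

(** y_k for 1 <= k <= n, and a dummy value for other [k]. *)
Definition yvar n (k : nat) : xypoly n :=
  if k is k'.+1 then oapp (fun j : 'I_n => 'X_(rshift n j)) 0 (insub k') else 0.

Definition oplus (R : pzRingType) (x y : R) : R := x + y - x * y.

(** The action of the transposition s_i on the x-variables. *)
Definition xswap n (i : 'I_n) (f : xypoly n) : xypoly n :=
  msym (tperm (lshift n i) (lshift n (ordS i))) f.

Lemma msym_var n (s : 'S_n) (k : 'I_n) : msym s 'X_k = 'X_(s k) :> {mpoly int[n]}.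
Proof.
rewrite msymX; congr 'X_[_]; apply/mnmP=> j.
by rewrite !mnmE -[in RHS](inj_eq (@perm_inj _ s^-1)) permK.
Qed.

Lemma xswap_var n (i k : 'I_n) : xswap i (xvar k) = xvar (adj i k).
Proof. by rewrite /xswap /xvar msym_var -(inj_tperm _ _ _ (@lshift_inj _ _)). Qed.

(** f - s_i f is divisible by x_i - x_{i+1}. *)
Lemma divdiff_exists n (i : 'I_n) (f : xypoly n) :
  exists g : xypoly n, (xvar i - xvar (ordS i)) * g == f - xswap i f.
Proof.
suff [g Hg] : exists g : xypoly n,
  (xvar i - xvar (ordS i)) * g = f - xswap i f by exists g; apply/eqP.
pose P (h : xypoly n) := exists g, (xvar i - xvar (ordS i)) * g = h - xswap i h.
have PM a b : P a -> P b -> P (a * b).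
  move=> [c Hc] [d Hd]; exists (c * b + xswap i a * d).
  by rewrite mulrDr mulrA Hc mulrCA Hd /xswap msymM mulrBl mulrBr addrA subrK.
have PX k : P 'X_k.
  rewrite /P /xswap msym_var; case: tpermP => [->|->|_ _].
  - by exists 1; rewrite mulr1.
  - by exists (-1); rewrite mulrN1 opprB.
  - by exists 0; rewrite mulr0 subrr.
have P1 : P 1 by exists 0; rewrite mulr0 /xswap msym1 subrr.
elim/mpolyind: f => [|c m p _ _ [g Hg]].
  by exists 0; rewrite mulr0 /xswap msym0 subr0.
have [h Hh] : P 'X_[m].
  rewrite (mpolyXE_id _ m); apply: (big_ind P P1 PM) => k _.
  elim: (m k) => [|e IHe]; first by rewrite expr0; exact: P1.
  by rewrite exprS; exact: (PM _ _ (PX k) IHe).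
exists (c *: h + g); rewrite mulrDr -scalerAr Hh Hg /xswap msymD msymZ scalerBr.
by rewrite opprD addrACA.
Qed.

(** The divided difference with respect to x_i and x_{i+1}. *)
Definition divdiff n (i : 'I_n) (f : xypoly n) : xypoly n :=
  xchoose (divdiff_exists i f).

Lemma divdiffE n (i : 'I_n) (f : xypoly n) :
  (xvar i - xvar (ordS i)) * divdiff i f = f - xswap i f.
Proof. exact/eqP/(xchooseP (divdiff_exists i f)). Qed.

(** The isobaric divided difference pi_i. *)
Definition isobaric n (i : 'I_n) (f : xypoly n) : xypoly n :=
  divdiff i ((1 - xvar (ordS i)) * f).

(** * Double Grothendieck polynomials *)

Definition ascent n (w : 'S_n) (i : 'I_n) : bool :=
  (i.+1 < n)%N && (perm_length (swap_at w i) == (perm_length w).+1).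

Definition groth_longest n : xypoly n :=
  \prod_(p : 'I_n * 'I_n | (p.1.+1 + p.2.+1 <= n)%N)
     oplus (xvar p.1) (yvar n p.2.+1).

Fixpoint groth_iter n (k : nat) (w : 'S_n) : xypoly n :=
  if w == longest n then groth_longest n
  else if k is k'.+1 then
    if [pick i | ascent w i] is Some i
    then isobaric i (groth_iter k' (swap_at w i)) else 0
  else 0.

(** Since [perm_length w <= n * n], the recursion does not run out of fuel before it
    reaches [longest n]; see [groth_longestE] and [groth_ascent] for the defining
    equations. *)
Definition groth n (w : 'S_n) : xypoly n :=
  groth_iter (n * n - perm_length w) w.

Lemma perm_length_le n (w : 'S_n) : (perm_length w <= n * n)%N.
Proof. by apply: leq_trans (max_card _) _; rewrite card_prod !card_ord. Qed.

Lemma groth_longestE n : groth (longest n) = groth_longest n.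
Proof. by rewrite /groth; case: (_ - _)%N => [|k] /=; rewrite eqxx. Qed.

Lemma ordSE n (i : 'I_n) : (i.+1 < n)%N -> ordS i = i.+1 :> nat.
Proof. by move=> lt_i; rewrite /= modn_small. Qed.

Lemma swap_atK n (w : 'S_n) (i : 'I_n) : swap_at (swap_at w i) i = w.
Proof. by rewrite /swap_at mulgA tperm2 mul1g. Qed.

Lemma swap_atE n (w : 'S_n) (i k : 'I_n) : swap_at w i k = w (adj i k).
Proof. exact: permM. Qed.

Lemma adj_mono n (i a b : 'I_n) : (i.+1 < n)%N -> (a < b)%N ->
  (a, b) != (i, ordS i) -> (adj i a < adj i b)%N.
Proof.
rewrite /adj => /ordSE; move: (ordS i) => j Sj lt_ab.
rewrite xpair_eqE negb_and -!val_eqE /= => neq.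
case: (tpermP i j a) => [Ea|Ea|/eqP + /eqP]; case: (tpermP i j b) => [Eb|Eb|/eqP + /eqP];
  rewrite -?val_eqE ?Ea ?Eb /= in neq lt_ab *; lia.
Qed.

Lemma perm_length_swap n (w : 'S_n) (i : 'I_n) : (i.+1 < n)%N ->
  (w i < w (ordS i))%N -> perm_length (swap_at w i) = (perm_length w).+1.
Proof.
move=> lt_i; have := adj_mono lt_i; have := swap_atE w i; have := ordSE lt_i.
rewrite /adj; move: (ordS i) (swap_at w i) => j v Sj vE mono lt_w.
pose A (u : 'S_n) := [set p : 'I_n * 'I_n | (p.1 < p.2)%N && (u p.2 < u p.1)%N].
pose s (p : 'I_n * 'I_n) := (tperm i j p.1, tperm i j p.2).
have sK : involutive s by case=> a b; rewrite /s /= !tpermK.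
have Aii : (i, j) \in A (v).
  by rewrite inE /= !vE tpermL tpermR Sj ltnSn.
rewrite /perm_length -/(A w) -/(A (v)) (cardsD1 (i, j)) Aii add1n.
congr _.+1; rewrite -(card_imset (A w) (can_inj sK)); apply/eq_card => p.
rewrite -[in RHS](sK p) (mem_imset _ _ (can_inj sK)) !inE /= !vE.
case: p => a b /=; have [[-> ->]|neq] /= := eqVneq.
  by rewrite tpermL tpermR Sj ltnNge ltnW.
have [lt_ab|le_ba] /= := ltnP a b; first by rewrite mono.
move: le_ba; rewrite leq_eqVlt => /orP[/eqP/val_inj->|lt_ba]; first by rewrite ltnn.
have [[-> ->]|neq'] := eqVneq (b, a) (i, j).
  by rewrite tpermL tpermR [(w j < _)%N]ltnNge (ltnW lt_w) andbF.
by rewrite ltnNge ltnW // mono.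
Qed.

Lemma ascentE n (w : 'S_n) (i : 'I_n) :
  ascent w i = (i.+1 < n)%N && (w i < w (ordS i))%N.
Proof.
rewrite /ascent; case: (boolP (i.+1 < n)%N) => //= lt_i.
have [lt_w|] := ltnP (w i); first by rewrite perm_length_swap // eqxx.
have neq_i : (ordS i == i) = false by rewrite -val_eqE (ordSE lt_i : val _ = _) gtn_eqF.
rewrite leq_eqVlt val_eqE (inj_eq perm_inj) neq_i /= => lt_w.
have: perm_length (swap_at (swap_at w i) i) = (perm_length (swap_at w i)).+1.
  by apply: perm_length_swap; rewrite // !swap_atE /adj tpermL tpermR.
by rewrite swap_atK => ->; apply/negbTE; rewrite neq_ltn leqW.
Qed.

Lemma ascent_exists n (w : 'S_n) : w != longest n -> exists i, ascent w i.
Proof.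
move=> neq_w; apply/existsP; apply: contraR neq_w; rewrite negb_exists => /forallP noasc.
have desc (i j : 'I_n) : j = i.+1 :> nat -> (w j < w i)%N.
  move=> def_j; have lt_i : (i.+1 < n)%N by rewrite -def_j.
  have Ej : j = ordS i by apply: val_inj; rewrite /= modn_small.
  have := noasc i; rewrite ascentE lt_i /= -Ej.
  have neq_j : (j == i) = false by rewrite -val_eqE /= def_j gtn_eqF.
  by rewrite -leqNgt leq_eqVlt val_eqE (inj_eq perm_inj) neq_j.
have below d (i j : 'I_n) : j = (i + d)%N :> nat -> (w j + d <= w i)%N.
  elim: d j => [|d IHd] j def_j.
    by rewrite addn0 (_ : j = i) //; apply: val_inj; rewrite /= def_j addn0.
  have lt_d : (i + d < n)%N by have := ltn_ord j; lia.
  have := IHd (Ordinal lt_d) erefl; have := desc (Ordinal lt_d) j.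
  by rewrite /= def_j addnS => /(_ erefl); lia.
apply/eqP/permP => i; apply: val_inj; rewrite permE /=.
have n_gt0 : (0 < n)%N by have := ltn_ord i; lia.
have lt_n1 : (n.-1 < n)%N by lia.
have := below i (Ordinal n_gt0) i erefl.
have := below (n.-1 - i)%N i (Ordinal lt_n1).
have := ltn_ord (w (Ordinal n_gt0)); have := ltn_ord i => /=; lia.
Qed.

Lemma groth_pick n (w : 'S_n) : w != longest n ->
  exists2 i, ascent w i & groth w = isobaric i (groth (swap_at w i)).
Proof.
move=> neq_w; have [j asc_j] := ascent_exists neq_w.
have := perm_length_le (swap_at w j).
case/andP: (asc_j) => _ /eqP-> lt_len; rewrite {1}/groth.
case def_k: (n * n - perm_length w)%N => [|k] /=; first by lia.
rewrite (negbTE neq_w); case: pickP => [i asc_i|/(_ j)]; last by rewrite asc_j.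
exists i; first exact: asc_i.
case/andP: asc_i => _ /eqP Ei; rewrite /groth Ei.
by have -> : (n * n - (perm_length w).+1)%N = k by lia.
Qed.

(** The choice of [i] in the recursion is irrelevant, because the operators
    [isobaric i] satisfy the braid relations. *)

Lemma xswapB n (i : 'I_n) : {morph xswap i : f g / f - g}.
Proof. exact: msymB. Qed.

Lemma xswapM n (i : 'I_n) : {morph xswap i : f g / f * g}.
Proof. exact: msymM. Qed.

Lemma xswap1 n (i : 'I_n) : xswap i 1 = 1.
Proof. exact: msym1. Qed.

Lemma xswapK n (i : 'I_n) : involutive (xswap i).
Proof. by move=> f; rewrite /xswap -msymMm tperm2 msym1m. Qed.

Lemma xvarB_neq0 n (i j : 'I_n) : i != j -> xvar i - xvar j != 0.
Proof.
apply: contra; rewrite subr_eq0 => /eqP E.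
have := congr1 (fun p : {mpoly int[n + n]} => p@_U_(lshift n i)) E.
rewrite !mcoeffX eqxx; case: eqP => [/mnmP/(_ (lshift n i))|_ /eqP]; last first.
  by rewrite oner_eq0.
by rewrite !mnm1E eqxx (inj_eq (@lshift_inj _ _)) eq_sym; case: (i == j).
Qed.

Lemma isobaricE n (i : 'I_n) (f : xypoly n) :
  (xvar i - xvar (ordS i)) * isobaric i f =
  (1 - xvar (ordS i)) * f - (1 - xvar i) * xswap i f.
Proof.
by rewrite /isobaric divdiffE xswapM xswapB xswap1 xswap_var /adj tpermR.
Qed.

Lemma sym_aux (R : idomainType) (a b f fi g gi : R) : a - b != 0 ->
  (a - b) * g = (1 - b) * f - (1 - a) * fi ->
  (b - a) * gi = (1 - a) * fi - (1 - b) * f ->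
  gi = g.
Proof.
move=> nz Eg Egi; apply: (mulfI nz); rewrite Eg.
by rewrite -[LHS]opprK -mulNr opprB Egi opprB.
Qed.

Lemma xswap_isobaric n (i : 'I_n) (f : xypoly n) : i != ordS i ->
  xswap i (isobaric i f) = isobaric i f.
Proof.
move=> neq_i; have Eg := isobaricE i f; have := congr1 (xswap i) Eg.
rewrite !(xswapB, xswapM, xswap1) xswapK !xswap_var /adj tpermL tpermR.
exact: (@sym_aux (xypoly n) _ _ _ _ _ _ (xvarB_neq0 neq_i) Eg).
Qed.

Lemma braid_aux (R : idomainType)
  (a b c f fi fj fij fji fw g gj gij h hi l g' gi' gji' h' hj' l' : R) :
  a - b != 0 -> b - c != 0 -> a - c != 0 ->
  (a - b) * g = (1 - b) * f - (1 - a) * fi ->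
  (a - c) * gj = (1 - c) * fj - (1 - a) * fji ->
  (b - c) * gij = (1 - c) * fij - (1 - b) * fw ->
  (b - c) * h = (1 - c) * g - (1 - b) * gj ->
  (a - c) * hi = (1 - c) * g - (1 - a) * gij ->
  (a - b) * l = (1 - b) * h - (1 - a) * hi ->
  (b - c) * g' = (1 - c) * f - (1 - b) * fj ->
  (a - c) * gi' = (1 - c) * fi - (1 - a) * fij ->
  (a - b) * gji' = (1 - b) * fji - (1 - a) * fw ->
  (a - b) * h' = (1 - b) * g' - (1 - a) * gi' ->
  (a - c) * hj' = (1 - c) * g' - (1 - a) * gji' ->
  (b - c) * l' = (1 - c) * h' - (1 - b) * hj' ->
  l = l'.
Proof.
move=> ab bc ac Eg Egj Egij Eh Ehi El Eg' Egi' Egji' Eh' Ehj' El'.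
apply: (mulfI (mulf_neq0 ab (mulf_neq0 bc ac))).
transitivity ((1 - b) * (a - c) * ((b - c) * h) - (1 - a) * (b - c) * ((a - c) * hi)).
  transitivity ((b - c) * (a - c) * ((a - b) * l)); first by ring.
  by rewrite El; ring.
transitivity ((1 - c) * (a - c) * ((a - b) * h') - (1 - b) * (a - b) * ((a - c) * hj')); last first.
  transitivity ((a - b) * (a - c) * ((b - c) * l')); last by ring.
  by rewrite El'; ring.
rewrite Eh Ehi Eh' Ehj'.
transitivity ((1 - c) * (1 - c) * ((a - b) * g) - (1 - b) * (1 - b) * ((a - c) * gj)
              + (1 - a) * (1 - a) * ((b - c) * gij)); first by ring.
transitivity ((1 - b) * (1 - c) * ((b - c) * g') - (1 - c) * (1 - a) * ((a - c) * gi')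
              + (1 - b) * (1 - a) * ((a - b) * gji')); last by ring.
by rewrite Eg Egj Egij Eg' Egi' Egji'; ring.
Qed.

Lemma commute_aux (R : idomainType)
  (a b c d f fi fj fij g gi l g' gj' l' : R) : a - b != 0 -> c - d != 0 ->
  (c - d) * g = (1 - d) * f - (1 - c) * fj ->
  (c - d) * gi = (1 - d) * fi - (1 - c) * fij ->
  (a - b) * l = (1 - b) * g - (1 - a) * gi ->
  (a - b) * g' = (1 - b) * f - (1 - a) * fi ->
  (a - b) * gj' = (1 - b) * fj - (1 - a) * fij ->
  (c - d) * l' = (1 - d) * g' - (1 - c) * gj' ->
  l = l'.
Proof.
move=> ab cd Eg Egi El Eg' Egj' El'; apply: (mulfI (mulf_neq0 ab cd)).
transitivity ((1 - b) * ((c - d) * g) - (1 - a) * ((c - d) * gi)).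
  transitivity ((c - d) * ((a - b) * l)); first by ring.
  by rewrite El; ring.
transitivity ((1 - d) * ((a - b) * g') - (1 - c) * ((a - b) * gj')); last first.
  transitivity ((a - b) * ((c - d) * l')); last by ring.
  by rewrite El'; ring.
by rewrite Eg Egi Eg' Egj'; ring.
Qed.

Lemma ordS_val n (i j : 'I_n) : j = i.+1 :> nat -> ordS i = j.
Proof. by move=> Sj; apply: ord_inj; rewrite ordSE -?Sj. Qed.

Lemma xswap_eq n (i a b : 'I_n) (f g h : xypoly n) :
  (xvar a - xvar b) * g = (1 - xvar b) * f - (1 - xvar a) * h ->
  (xvar (adj i a) - xvar (adj i b)) * xswap i g =
  (1 - xvar (adj i b)) * xswap i f - (1 - xvar (adj i a)) * xswap i h.
Proof. by move/(congr1 (xswap i)); rewrite !(xswapB, xswapM, xswap1, xswap_var). Qed.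

Lemma xswap_eq_sym n (i a b : 'I_n) (f g h : xypoly n) : xswap i f = f ->
  (xvar a - xvar b) * g = (1 - xvar b) * f - (1 - xvar a) * h ->
  (xvar (adj i a) - xvar (adj i b)) * xswap i g =
  (1 - xvar (adj i b)) * f - (1 - xvar (adj i a)) * xswap i h.
Proof. by move=> Sf /(xswap_eq i); rewrite Sf. Qed.

Lemma tperm_braid (T : finType) (x y z : T) : x != y -> y != z -> x != z ->
  (tperm x y * (tperm y z * tperm x y) = tperm y z * (tperm x y * tperm y z))%g.
Proof.
have tJ (u v t : T) : u != t -> v != t ->
    (tperm u v * (tperm v t * tperm u v) = tperm u t)%g.
  by move=> ut vt; rewrite -{1}tpermV -conjgE tpermJ tpermR tpermD.
move=> xy yz xz; rewrite tJ // [tperm y z]tpermC [tperm x y]tpermC.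
by rewrite tJ 1?[z == x]eq_sym 1?[y == x]eq_sym ?[_ == x]eq_sym // tpermC.
Qed.

Lemma isobaric_braid n (i j : 'I_n) (f : xypoly n) : j = i.+1 :> nat -> (j.+1 < n)%N ->
  isobaric i (isobaric j (isobaric i f)) = isobaric j (isobaric i (isobaric j f)).
Proof.
move=> Sj lt_j; have Ei := ordS_val Sj.
have [k Ek Sk] : exists2 k, ordS j = k & k = j.+1 :> nat.
  by exists (ordS j); rewrite ?ordSE.
have ij : i != j by rewrite -val_eqE /=; lia.
have jk : j != k by rewrite -val_eqE /=; lia.
have ik : i != k by rewrite -val_eqE /=; lia.
have aii : adj i i = j by rewrite /adj Ei tpermL.
have aij : adj i j = i by rewrite /adj Ei tpermR.
have aik : adj i k = k by rewrite /adj Ei tpermD.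
have aji : adj j i = i by rewrite /adj Ek tpermD // eq_sym.
have ajj : adj j j = k by rewrite /adj Ek tpermL.
have ajk : adj j k = j by rewrite /adj Ek tpermR.
have Pi h : (xvar i - xvar j) * isobaric i h =
    (1 - xvar j) * h - (1 - xvar i) * xswap i h by rewrite -Ei isobaricE.
have Pj h : (xvar j - xvar k) * isobaric j h =
    (1 - xvar k) * h - (1 - xvar j) * xswap j h by rewrite -Ek isobaricE.
have Si h : xswap i (isobaric i h) = isobaric i h by rewrite xswap_isobaric ?Ei.
have Sj' h : xswap j (isobaric j h) = isobaric j h by rewrite xswap_isobaric ?Ek.
have Ew : xswap i (xswap j (xswap i f)) = xswap j (xswap i (xswap j f)).
  have lE x y : (lshift n x == lshift n y) = (x == y) by apply: (inj_eq (@lshift_inj _ _)).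
  by rewrite /xswap Ei Ek -!msymMm tperm_braid ?lE.
have Egj := xswap_eq j (Pi f); rewrite aji ajj in Egj.
have Egij := xswap_eq i Egj; rewrite aii aik Ew in Egij.
have Ehi := xswap_eq_sym (Si f) (Pj (isobaric i f)); rewrite aij aik in Ehi.
have Egi := xswap_eq i (Pj f); rewrite aij aik in Egi.
have Egji := xswap_eq j Egi; rewrite aji ajk in Egji.
have Ehj := xswap_eq_sym (Sj' f) (Pi (isobaric j f)); rewrite aji ajj in Ehj.
exact: (@braid_aux (xypoly n) _ _ _ _ _ _ _ _ _ _ _ _ _ _ _ _ _ _ _ _ _
  (xvarB_neq0 ij) (xvarB_neq0 jk) (xvarB_neq0 ik)
  (Pi f) Egj Egij (Pj _) Ehi (Pi _) (Pj f) Egi Egji (Pi _) Ehj (Pj _)).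
Qed.

Lemma isobaric_commute n (i j : 'I_n) (f : xypoly n) : (i.+1 < j)%N -> (j.+1 < n)%N ->
  isobaric i (isobaric j f) = isobaric j (isobaric i f).
Proof.
move=> lt_ij lt_j; have lt_i : (i.+1 < n)%N by lia.
have [i' Ei Si] : exists2 k, ordS i = k & k = i.+1 :> nat.
  by exists (ordS i); rewrite ?ordSE.
have [j' Ej Sj] : exists2 k, ordS j = k & k = j.+1 :> nat.
  by exists (ordS j); rewrite ?ordSE.
have neq (x y : 'I_n) : (x < y)%N -> (x != y) && (y != x).
  by move=> lt_xy; rewrite [y == x]eq_sym andbb -val_eqE /=; lia.
have /andP[ij ji] := neq i j (ltnW lt_ij).
have /andP[ij' j'i] : (i != j') && (j' != i) by apply: neq; lia.
have /andP[i'j ji'] : (i' != j) && (j != i') by apply: neq; lia.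
have /andP[i'j' j'i'] : (i' != j') && (j' != i') by apply: neq; lia.
have /andP[ii' _] : (i != i') && (i' != i) by apply: neq; lia.
have /andP[jj' _] : (j != j') && (j' != j) by apply: neq; lia.
have Pi h : (xvar i - xvar i') * isobaric i h =
    (1 - xvar i') * h - (1 - xvar i) * xswap i h by rewrite -Ei isobaricE.
have Pj h : (xvar j - xvar j') * isobaric j h =
    (1 - xvar j') * h - (1 - xvar j) * xswap j h by rewrite -Ej isobaricE.
have Ew : xswap i (xswap j f) = xswap j (xswap i f).
  have lE x y : (lshift n x == lshift n y) = (x == y) by apply: (inj_eq (@lshift_inj _ _)).
  by rewrite /xswap Ei Ej -!msymMm conjgC tpermJ !tpermD ?lE.
have aij : adj i j = j by rewrite /adj Ei tpermD.
have aij' : adj i j' = j' by rewrite /adj Ei tpermD.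
have aji : adj j i = i by rewrite /adj Ej tpermD.
have aji' : adj j i' = i' by rewrite /adj Ej tpermD.
have Eg := xswap_eq i (Pj f); rewrite aij aij' Ew in Eg.
have Eg' := xswap_eq j (Pi f); rewrite aji aji' in Eg'.
exact: (@commute_aux (xypoly n) _ _ _ _ _ _ _ _ _ _ _ _ _ _
  (xvarB_neq0 ii') (xvarB_neq0 jj') (Pj f) Eg (Pi _) (Pi f) Eg' (Pj _)).
Qed.

Lemma longest_ascent n (i : 'I_n) : ascent (longest n) i = false.
Proof.
rewrite ascentE !permE; apply/negbTE; apply/negP => /andP[lt_i].
by rewrite ltnNge /= modn_small // leq_sub2l.
Qed.

Lemma groth_ascent n (w : 'S_n) (i : 'I_n) : ascent w i ->
  groth w = isobaric i (groth (swap_at w i)).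
Proof.
have [m] := ubnP (n * n - perm_length w); elim: m w i => // m IHm w i lt_m asc_i.
have step (v : 'S_n) (k : 'I_n) : ascent v k -> (n * n - perm_length v < m.+1)%N ->
    (n * n - perm_length (swap_at v k) < m)%N.
  move=> /andP[_ /eqP Ev]; have := perm_length_le (swap_at v k); lia.
have [Ew|/groth_pick[j asc_j ->]] := eqVneq w (longest n).
  by rewrite Ew longest_ascent in asc_i.
suff main (a b : 'I_n) : ascent w a -> ascent w b -> (a < b)%N ->
    isobaric a (groth (swap_at w a)) = isobaric b (groth (swap_at w b)).
  have [lt_ij|lt_ji|/ord_inj->//] := ltngtP i j.
    exact/esym/main.
  exact: main.
move=> asc_a asc_b lt_ab; have la := step w a asc_a lt_m; have lb := step w b asc_b lt_m.
have [lt_a wa] := andP (etrans (esym (ascentE w a)) asc_a).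
have [lt_b wb] := andP (etrans (esym (ascentE w b)) asc_b).
have [a' Ea Sa] : exists2 k, ordS a = k & k = a.+1 :> nat.
  by exists (ordS a); rewrite ?ordSE.
have [b' Eb Sb] : exists2 k, ordS b = k & k = b.+1 :> nat.
  by exists (ordS b); rewrite ?ordSE.
rewrite Ea in wa; rewrite Eb in wb.
have neq (x y : 'I_n) : (x < y)%N -> (x != y) * (y != x).
  by rewrite [y == x]eq_sym -val_eqE ltn_neqAle => /andP[-> _].
have ab := neq _ _ lt_ab.
have ab' : (a != b') * (b' != a) by apply: neq; rewrite Sb ltnS ltnW.
have bb' : (b != b') * (b' != b) by apply: neq; rewrite Sb.
have aa : adj a a = a' by rewrite /adj Ea tpermL.
have aa' : adj a a' = a by rewrite /adj Ea tpermR.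
have bb : adj b b = b' by rewrite /adj Eb tpermL.
have bb1 : adj b b' = b by rewrite /adj Eb tpermR.
have ba : adj b a = a by rewrite /adj Eb tpermD ?ab ?ab'.
have a'b' : (a' != b') * (b' != a') by apply: neq; rewrite Sa Sb ltnS.
have ab1 : adj a b' = b' by rewrite /adj Ea tpermD ?ab' ?a'b'.
have [Eab|neq_ab] := eqVneq a' b.
  have {aa'} aab : adj a b = a by rewrite -Eab.
  have {}aa : adj a a = b by rewrite aa.
  have asc1 : ascent (swap_at w a) b.
    by rewrite ascentE Eb lt_b !swap_atE aab ab1 (ltn_trans wa) // Eab.
  have asc2 : ascent (swap_at w b) a.
    by rewrite ascentE Ea Eab lt_a !swap_atE bb ba (ltn_trans wa) // Eab.
  have la' := step _ _ asc1 (ltnW la); have lb' := step _ _ asc2 (ltnW lb).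
  have asc3 : ascent (swap_at (swap_at w a) b) a.
    by rewrite ascentE Ea Eab lt_a !swap_atE ba bb aa ab1.
  have asc4 : ascent (swap_at (swap_at w b) a) b.
    by rewrite ascentE Eb lt_b !swap_atE aab ab1 ba bb1 -Eab.
  rewrite (IHm _ _ la asc1) (IHm _ _ lb asc2) (IHm _ _ la' asc3) (IHm _ _ lb' asc4).
  have -> : swap_at (swap_at (swap_at w a) b) a = swap_at (swap_at (swap_at w b) a) b.
    rewrite /swap_at !mulgA; congr (_ * w)%g; rewrite -!mulgA /adj Ea Eb Eab.
    by rewrite tperm_braid ?ab ?bb' ?ab'.
  have Sb1 : b = a.+1 :> nat by rewrite -Eab.
  exact: (isobaric_braid _ Sb1 lt_b).
have lt_a'b : (a' < b)%N.
  by rewrite ltn_neqAle Sa lt_ab andbT -Sa; apply: contraNneq neq_ab => /ord_inj->.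
have a'b : (a' != b) * (b != a') by apply: neq.
have aab : adj a b = b by rewrite /adj Ea tpermD ?ab ?a'b.
have ba' : adj b a' = a' by rewrite /adj Eb tpermD ?a'b ?a'b'.
have asc1 : ascent (swap_at w a) b by rewrite ascentE Eb lt_b !swap_atE aab ab1.
have asc2 : ascent (swap_at w b) a by rewrite ascentE Ea lt_a !swap_atE ba ba'.
rewrite (IHm _ _ la asc1) (IHm _ _ lb asc2).
have -> : swap_at (swap_at w a) b = swap_at (swap_at w b) a.
  rewrite /swap_at !mulgA; congr (_ * w)%g; rewrite conjgC; congr (_ * _)%g.
  have bE : adj b = tperm b b' by rewrite /adj Eb.
  by rewrite bE tpermJ aab ab1.
have lt_ab1 : (a.+1 < b)%N by rewrite -Sa.
exact: (isobaric_commute _ lt_ab1 lt_b).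
Qed.

(* Main.v *)
Require Import Defs.
From mathcomp Require Import all_boot all_order all_algebra all_fingroup.
From mathcomp Require Import ring zify.
From mathcomp Require Import mpoly.

Set Implicit Arguments.
Unset Strict Implicit.
Unset Printing Implicit Defensive.

Import GRing.Theory.
Local Open Scope ring_scope.

(** Proof idea.

    (1) => (2). The Fomin-Kirillov row factorization expresses the double
    Grothendieck polynomials as the values of a function [pipes] on [S_n]: it is
    built from left 0-Hecke factors [1 + (x_t (+) y_(c-t+1)) u_c], one row [t] at a
    time, and the Yang-Baxter relation shows that it satisfies the recursion by the
    isobaric operators. For a 1432-avoiding [w] the tableaux are built by the same
    factors: restrict to entries at least [t], with [t] occurring only in columns
    left of [c + 1]. A box with entry [t] in column [c] is then the top of its column
    and the end of its row. Adding [t] to this box gives the terms in which [u_c] acts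
    by -1; if the box is equal to [{t}], removing it turns column [c] into column
    [c + 1] and leaves a tableau for [s_c w]. Avoidance of 1432 makes the remaining
    terms of the Hecke action vanish.

    (2) => (1). Put [y = 0] and [x_i = X^(mu i)] for an injective positive weight
    [mu]. By induction along first ascents, the order at [X = 0] of the Grothendieck
    polynomial is the sum, over the columns of the Rothe diagram, of the least weight
    of a set componentwise below the column. If [w] has the pattern 1432 at the
    positions [a < c < b < d], make the rows in column [w b] lightest and the other
    rows above [c] second lightest.
    A tableau of that order would have the entry [c] in both boxes [(c, w d)] and
    [(c, w b)], and then its column [w d] can be made lighter: the formula has larger
    order than the polynomial. *)

(** * The 0-Hecke action *)

(** [inord] turns the index into an ordinal. Since [(s * t)%g] applies [s] first, [w * transp n c]
    exchanges values and [transp n c * w] exchanges positions. *)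
Definition transp n (c : nat) : 'S_n.+1 := tperm (inord c) (inord c.+1).

Section Transpositions.

Variable n : nat.
Implicit Types (w : 'S_n.+1) (a b : 'I_n.+1) (c d i : nat).

Definition vdesc c w : bool := ((w^-1)%g (inord c.+1) < (w^-1)%g (inord c))%N.

Definition pdesc i w : bool := (w (inord i.+1) < w (inord i))%N.

Lemma transpVE c w a : ((w * transp n c)^-1)%g a = (w^-1)%g (transp n c a).
Proof. by rewrite invMg permM tpermV. Qed.

Lemma transpVEr i w a : ((transp n i * w)^-1)%g a = transp n i ((w^-1)%g a).
Proof. by rewrite invMg permM tpermV. Qed.

Lemma eq_inord c d : (c <= n)%N -> (d <= n)%N -> (inord c == inord d :> 'I_n.+1) = (c == d).
Proof. by move=> lc ld; rewrite -val_eqE /= !inordK ?ltnS. Qed.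

Lemma transpL c : transp n c (inord c) = inord c.+1.
Proof. exact: tpermL. Qed.

Lemma transpR c : transp n c (inord c.+1) = inord c.
Proof. exact: tpermR. Qed.

Lemma transp_val c a : (c < n)%N ->
  transp n c a = (if a == c :> nat then c.+1 else if a == c.+1 :> nat then c else a) :> nat.
Proof.
move=> lc; rewrite /transp.
have E1 : (inord c : 'I_n.+1) = c :> nat by rewrite inordK // ltnS ltnW.
have E2 : (inord c.+1 : 'I_n.+1) = c.+1 :> nat by rewrite inordK.
case: tpermP => [->|->|/eqP + /eqP]; rewrite ?E1 ?E2 ?eqxx //.
  by rewrite gtn_eqF.
by rewrite -!val_eqE /= E1 E2 => /negbTE-> /negbTE->.
Qed.

Lemma transpD c d : (c < n)%N -> (d <= n)%N -> d != c -> d != c.+1 ->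
  transp n c (inord d) = inord d.
Proof. by move=> ? ? ? ?; rewrite /transp tpermD // eq_inord // 1?eq_sym //; lia. Qed.

Lemma transpK c : (transp n c * transp n c = 1)%g.
Proof. exact: tperm2. Qed.

Lemma mulg_transpK c w : (w * transp n c * transp n c = w)%g.
Proof. by rewrite -mulgA transpK mulg1. Qed.

Lemma transp_braid i : (i.+1 < n)%N ->
  (transp n i * (transp n i.+1 * transp n i) = transp n i.+1 * (transp n i * transp n i.+1))%g.
Proof. by move=> lt_i; rewrite tperm_braid // eq_inord //; lia. Qed.

Lemma transp_comm c d : (c.+1 < d)%N -> (d < n)%N ->
  (transp n c * transp n d = transp n d * transp n c)%g.
Proof.
by move=> lt_cd lt_d; rewrite conjgC tpermJ !transpD //; lia.
Qed.

End Transpositions.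

Lemma nat_transp_lt (c p q : nat) : p != q ->
  ~~ ((p == c) && (q == c.+1)) -> ~~ ((p == c.+1) && (q == c)) ->
  ((if q == c then c.+1 else if q == c.+1 then c else q) <
   (if p == c then c.+1 else if p == c.+1 then c else p))%N = (q < p)%N.
Proof.
by case: (p =P c) => ?; case: (p =P c.+1) => ?; case: (q =P c) => ?; case: (q =P c.+1) => ?; lia.
Qed.

Section HeckeOperators.

Variables (n : nat) (A : comNzRingType).
Local Notation fn := {ffun 'S_n.+1 -> A}.
Implicit Types (phi psi : fn) (w : 'S_n.+1) (c d i t k : nat) (a b x z : A).

Definition lincomb a b phi psi : fn := [ffun w => a * phi w + b * psi w].

(** [phi] stands for the sum of the [phi w] times basis elements of the 0-Hecke algebra; this is
    multiplication by the generator u_c, with u_c^2 = - u_c, on the side of values, and [rhecke] is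
    its analogue on the side of positions. *)
Definition hecke c phi : fn :=
  [ffun w => if vdesc c w then phi (w * transp n c)%g - phi w else 0].

Definition rhecke i phi : fn :=
  [ffun w => if pdesc i w then phi (transp n i * w)%g - phi w else 0].

Definition hfactor c z phi : fn := lincomb 1 z phi (hecke c phi).

(* (1 - X) h_c(z) for z = (Y - X) / (1 - X), the element with X (+) z = Y *)
Definition gfactor c (X Y : A) phi : fn := lincomb (1 - X) (Y - X) phi (hecke c phi).

Lemma hecke_lincomb c a b phi psi :
  hecke c (lincomb a b phi psi) = lincomb a b (hecke c phi) (hecke c psi).
Proof. by apply/ffunP => w; rewrite !ffunE; case: vdesc; ring. Qed.

Lemma hfactor_lincomb c z a b phi psi :
  hfactor c z (lincomb a b phi psi) = lincomb a b (hfactor c z phi) (hfactor c z psi).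
Proof. by rewrite /hfactor hecke_lincomb; apply/ffunP => w; rewrite !ffunE; ring. Qed.

(** From u_i^2 = - u_i follows h_i(z) h_i(z') = h_i(z (+) z'). The coefficient 0 makes [lincomb] a
    multiplication by 1 - X. *)
Lemma hfactor_oplus i (X Y y : A) phi :
  hfactor i (oplus X y) (gfactor i X Y phi) =
  lincomb (1 - X) 0 (hfactor i (oplus Y y) phi) phi.
Proof.
apply/ffunP => w; rewrite !ffunE /vdesc !transpVE !(transpL, transpR) mulg_transpK /oplus.
by case: ltngtP => *; ring.
Qed.

(** A division-free form of the Yang-Baxter relation: [gfactor] passes two factors and exchanges
    their X and Y. *)
Lemma yang_baxter i (X Y y : A) phi : (i.+1 < n)%N ->
  hfactor i (oplus X y) (hfactor i.+1 (oplus Y y) (gfactor i X Y phi)) =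
  gfactor i.+1 X Y (hfactor i (oplus Y y) (hfactor i.+1 (oplus X y) phi)).
Proof.
move=> lt_i; apply/ffunP => w.
have T1 : transp n i (inord i.+2) = inord i.+2 by rewrite transpD //; lia.
have T2 : transp n i.+1 (inord i) = inord i by rewrite transpD //; lia.
have neq c d : (c <= n)%N -> (d <= n)%N -> c != d ->
    val ((w^-1)%g (inord c)) <> val ((w^-1)%g (inord d)).
  by move=> lc ld ne /val_inj/perm_inj/eqP; rewrite eq_inord //; apply/negP.
have N01 := neq i i.+1 (ltac:(lia)) (ltac:(lia)) (ltac:(lia)).
have N12 := neq i.+1 i.+2 (ltac:(lia)) (ltac:(lia)) (ltac:(lia)).
have N02 := neq i i.+2 (ltac:(lia)) (ltac:(lia)) (ltac:(lia)).
rewrite !ffunE /vdesc !transpVE !(transpL, transpR, T1, T2) ?mulg_transpK.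
have := transp_braid lt_i; rewrite !mulgA => braid.
have {braid} -> : (w * transp n i * transp n i.+1 * transp n i =
    w * transp n i.+1 * transp n i * transp n i.+1)%g by rewrite -!mulgA !(mulgA (transp n _)) braid.
move: N01 N12 N02; rewrite /= {neq}.
move: (nat_of_ord ((w^-1)%g (inord i))) (nat_of_ord ((w^-1)%g (inord i.+1)))
  (nat_of_ord ((w^-1)%g (inord i.+2))) => p q r.
rewrite /oplus.
(* The branches taken at [w] depend only on the order of the positions [p], [q], [r] of the values
   i, i + 1, i + 2; each of the six orders leaves a polynomial identity. *)
case: (ltngtP p q) => //; case: (ltngtP q r) => //; case: (ltngtP p r) => // *; 
  try lia; try ring.
Qed.

Lemma hecke_comm c d phi : (c.+1 < d)%N -> (d < n)%N ->
  hecke c (hecke d phi) = hecke d (hecke c phi).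
Proof.
move=> lt_cd lt_d; apply/ffunP => w; rewrite !ffunE /vdesc !transpVE !transpD //; try lia.
have E : (w * transp n c * transp n d = w * transp n d * transp n c)%g.
  by rewrite -!mulgA transp_comm.
by rewrite E; do 2!case: (_ < _)%N; ring.
Qed.

Lemma hecke_hfactor c d z phi : (c.+1 < d)%N -> (d < n)%N ->
  hecke c (hfactor d z phi) = hfactor d z (hecke c phi).
Proof. by move=> lt_cd lt_d; rewrite /hfactor hecke_lincomb hecke_comm. Qed.

Lemma hfactor_comm c d z z' phi : (c.+1 < d)%N -> (d < n)%N ->
  hfactor c z (hfactor d z' phi) = hfactor d z' (hfactor c z phi).
Proof.
by move=> lt_cd lt_d; rewrite {1}/hfactor hecke_hfactor // -hfactor_lincomb.
Qed.

Lemma rhecke_lincomb i a b phi psi :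
  rhecke i (lincomb a b phi psi) = lincomb a b (rhecke i phi) (rhecke i psi).
Proof. by apply/ffunP => w; rewrite !ffunE; case: pdesc; ring. Qed.

(** Left and right multiplication commute. They interact only when the positions i, i + 1 hold the
    values c, c + 1, and then either both sides vanish or s_i w = w s_c. *)
Lemma rhecke_hecke i c phi : (i < n)%N -> (c < n)%N ->
  rhecke i (hecke c phi) = hecke c (rhecke i phi).
Proof.
move=> lt_i lt_c; apply/ffunP => w; rewrite !ffunE /vdesc /pdesc.
have invE (x y : 'I_n.+1) : (w x == y) = ((w^-1)%g y == x).
  by apply/eqP/eqP => <-; rewrite ?permK ?permKV.
have := invE (inord i) (inord c); have := invE (inord i) (inord c.+1).
have := invE (inord i.+1) (inord c); have := invE (inord i.+1) (inord c.+1).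
have neqw : w (inord i) != w (inord i.+1) by rewrite (inj_eq perm_inj) eq_inord //; lia.
have neqv : (w^-1)%g (inord c) != (w^-1)%g (inord c.+1).
  by rewrite (inj_eq perm_inj) eq_inord //; lia.
have [/andP[/eqP Ei /eqP Ei1] | ne1] :=
  boolP ((w (inord i) == inord c) && (w (inord i.+1) == inord c.+1)).
  have -> : (w^-1)%g (inord c) = inord i by rewrite -Ei permK.
  have -> : (w^-1)%g (inord c.+1) = inord i.+1 by rewrite -Ei1 permK.
  by rewrite Ei Ei1 !inordK ?ltnS ?(ltnW lt_i) ?(ltnW lt_c) // !ltnNge !leqnSn.
have [/andP[/eqP Ei /eqP Ei1] | ne2] :=
  boolP ((w (inord i) == inord c.+1) && (w (inord i.+1) == inord c)).
  have P1 : (w^-1)%g (inord c.+1) = inord i by rewrite -Ei permK.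
  have P2 : (w^-1)%g (inord c) = inord i.+1 by rewrite -Ei1 permK.
  have Ew : (transp n i * w = w * transp n c)%g.
    by rewrite conjgC tpermJ Ei Ei1 /transp tpermC.
  rewrite !(permM, transpVEr, P1, P2, Ei, Ei1, transpL, transpR) Ew.
  by rewrite !inordK ?ltnS ?(ltnW lt_i) ?(ltnW lt_c) // !leqnn [(c.+1 < c)%N]ltnNge [(i.+1 < i)%N]ltnNge !leqnSn.
move: ne1 ne2 neqw neqv; rewrite !permM !transpVEr.
rewrite -!val_eqE /= !transp_val // !inordK ?ltnS // ?(ltnW lt_c) ?(ltnW lt_i) // mulgA.
move: (nat_of_ord (w (inord i))) (nat_of_ord (w (inord i.+1))) => p q.
move: (nat_of_ord ((w^-1)%g (inord c))) (nat_of_ord ((w^-1)%g (inord c.+1))) => r s.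
move=> ne1 ne2 neqw neqv e1 e2 e3 e4.
rewrite !nat_transp_lt -?e1 -?e2 -?e3 -?e4 //; last by rewrite andbC.
by case: (q < p)%N; case: (s < r)%N; ring.
Qed.

Lemma rhecke_hfactor i c z phi : (i < n)%N -> (c < n)%N ->
  rhecke i (hfactor c z phi) = hfactor c z (rhecke i phi).
Proof. by move=> lt_i lt_c; rewrite /hfactor rhecke_lincomb rhecke_hecke. Qed.

Definition deltaf : fn := [ffun w => (w == 1%g)%:R].

Lemma rhecke_delta i : (i < n)%N -> rhecke i deltaf = hecke i deltaf.
Proof.
move=> lt_i; apply/ffunP => w; rewrite !ffunE.
have E : (transp n i * w == 1)%g = (w == transp n i).
  by rewrite -(inj_eq (mulgI (transp n i))) mulgA transpK mul1g mulg1.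
have E' : (w * transp n i == 1)%g = (w == transp n i).
  by rewrite -(inj_eq (mulIg (transp n i))) mulg_transpK mul1g.
rewrite E E' /vdesc /pdesc; case: (w =P transp n i) => [->|_].
  by rewrite tpermV !(transpL, transpR).
case: (w =P 1%g) => [->|_]; last by rewrite subrr !if_same.
by rewrite invg1 !perm1 !inordK ?ltnS ?(ltnW lt_i) // !ltnNge !leqnSn.
Qed.

(** * Rows of Hecke factors and the exchange of two adjacent rows *)

Variable y : nat -> A.

Fixpoint hrow x t k phi : fn :=
  if k is k'.+1 then hfactor (t + k')%N (oplus x (y k)) (hrow x t k' phi) else phi.

Lemma row_lincomb x t k a b phi psi :
  hrow x t k (lincomb a b phi psi) = lincomb a b (hrow x t k phi) (hrow x t k psi).
Proof. by elim: k => //= k ->; rewrite hfactor_lincomb. Qed.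

Lemma rhecke_row i x t k phi : (i < n)%N -> (t + k <= n)%N ->
  rhecke i (hrow x t k phi) = hrow x t k (rhecke i phi).
Proof.
by move=> lt_i; elim: k => //= k IHk le_tk; rewrite rhecke_hfactor // ?IHk //; lia.
Qed.

Lemma hecke_row i x t k phi : (i.+1 < t)%N -> (t + k <= n)%N ->
  hecke i (hrow x t k phi) = hrow x t k (hecke i phi).
Proof.
by move=> lt_i; elim: k => //= k IHk le_tk; rewrite hecke_hfactor ?IHk //; lia.
Qed.

Lemma hfactor_row d z x t k phi : (t + k < d)%N -> (d < n)%N ->
  hfactor d z (hrow x t k phi) = hrow x t k (hfactor d z phi).
Proof.
by move=> + lt_d; elim: k => //= k IHk le_tk; rewrite -hfactor_comm ?IHk //; lia.
Qed.

(** Induction on the length: the last factor of the inner row commutes with the outer row of length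
    [k], the indices differing by at least 2, and [yang_baxter] then lets the [gfactor] pass both
    last factors. *)
Lemma row_exchange_gen i k (X Y : A) phi : (i + k < n)%N ->
  hrow X i k (hrow Y i.+1 k (gfactor i X Y phi)) =
  gfactor (i + k) X Y (hrow Y i k (hrow X i.+1 k phi)).
Proof.
elim: k => [|k IHk] lt_ik /=; first by rewrite addn0.
rewrite addSn -hfactor_row //; try lia.
rewrite IHk; last by lia.
rewrite yang_baxter; last by lia.
by rewrite addnS -[in RHS]hfactor_row //; lia.
Qed.

(** The outer row is longer by one factor, which absorbs the [gfactor] by [hfactor_oplus]. *)
Lemma row_exchange i k (X Y : A) phi : (i + k < n)%N ->
  hrow X i k.+1 (hrow Y i.+1 k (gfactor i X Y phi)) =
  lincomb (1 - X) 0 (hrow Y i k.+1 (hrow X i.+1 k phi)) (hrow Y i k (hrow X i.+1 k phi)).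
Proof. by move=> lt_ik /=; rewrite row_exchange_gen // hfactor_oplus. Qed.

Definition fmap (s : A -> A) phi : fn := [ffun w => s (phi w)].

Lemma fmap_row (s : {rmorphism A -> A}) x t k phi : (forall k, s (y k) = y k) ->
  fmap s (hrow x t k phi) = hrow (s x) t k (fmap s phi).
Proof.
move=> sy; elim: k => //= k <-; apply/ffunP => w; rewrite !ffunE.
by rewrite /oplus !(rmorphD, rmorphM, rmorph1, rmorphN) sy /= (fun_if s) rmorphB rmorph0.
Qed.

(** [rhecke i] commutes with both rows and becomes [hecke i] on [phi], so (1 - X) psi + (Y - X) R_i
    psi is the product of the rows applied to [gfactor i X Y phi]; by [row_exchange] it equals 1 - X
    times the image of psi under [s]. *)
Lemma isobaric_rows (s : {rmorphism A -> A}) i k (X Y : A) phi : (i + k < n)%N ->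
    (forall k, s (y k) = y k) -> s X = Y -> s Y = X -> fmap s phi = phi ->
    rhecke i phi = hecke i phi ->
  let psi := hrow X i k.+1 (hrow Y i.+1 k phi) in
  lincomb (X - Y) (X - Y) psi (rhecke i psi) = lincomb (1 - Y) (X - 1) psi (fmap s psi).
Proof.
move=> lt_ik sy sX sY sphi Rphi psi.
have := row_exchange X Y phi lt_ik; rewrite /gfactor !row_lincomb -Rphi.
have -> : fmap s psi = hrow Y i k.+1 (hrow X i.+1 k phi).
  by rewrite fmap_row // fmap_row // sX sY sphi.
have -> : rhecke i psi = hrow X i k.+1 (hrow Y i.+1 k (rhecke i phi)).
  by rewrite rhecke_row ?[in LHS]rhecke_row //; lia.
rewrite -/psi; move: psi (hrow _ _ k.+1 _) (hrow _ _ k.+1 _) => a c b.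
move=> /ffunP E; apply/ffunP => w; have {E} := E w; rewrite !ffunE mul0r addr0 => E.
have -> : (X - 1) * c w = - ((1 - X) * c w) by ring.
by rewrite -E; move: (a w) (b w) => ? ?; ring.
Qed.

(** At a descent psi + R_i psi takes the value psi(s_i w), which turns the identity into the
    equation that characterizes [isobaric]. *)
Lemma lincomb_rhecke_pdesc (s : A -> A) i (X Y : A) phi w : pdesc i w ->
  lincomb (X - Y) (X - Y) phi (rhecke i phi) = lincomb (1 - Y) (X - 1) phi (fmap s phi) ->
  (X - Y) * phi (transp n i * w)%g = (1 - Y) * phi w - (1 - X) * s (phi w).
Proof.
move=> desc_i /ffunP/(_ w); rewrite !ffunE desc_i -mulrDr subrKC => ->.
by rewrite -[X - 1]opprB mulNr.
Qed.

End HeckeOperators.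

(** * Row factorization of the double Grothendieck polynomials *)

Section PipeDreams.

Variable n : nat.
Local Notation R := (xypoly n.+1).
Implicit Types (w : 'S_n.+1) (i t d : nat).

Definition xv t : R := xvar (inord t).

Definition prow t k (phi : {ffun 'S_n.+1 -> R}) := hrow (yvar n.+1) (xv t) t k phi.

(** [pipes d] consists of the rows n - d, ..., n with the row n - d outermost, the row t having
    length n - t; [pipes n] is the full product. *)
Fixpoint pipes d : {ffun 'S_n.+1 -> R} :=
  prow (n - d) d (if d is d'.+1 then pipes d' else deltaf n R).

Lemma ordS_inord i : (i < n)%N -> ordS (inord i : 'I_n.+1) = inord i.+1.
Proof. by move=> lt_i; apply: val_inj; rewrite /= !inordK ?ltnS ?modn_small // ltnW. Qed.

Lemma adjE i : (i < n)%N -> adj (inord i) = transp n i.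
Proof. by move=> lt_i; rewrite /adj ordS_inord. Qed.

Definition xswapr i : {rmorphism R -> R} := msym (tperm (lshift n.+1 (inord i)) (lshift n.+1 (inord i.+1))).

Lemma xswaprE i f : (i < n)%N -> xswap (inord i) f = xswapr i f.
Proof. by move=> lt_i; rewrite /xswap ordS_inord. Qed.

Lemma xswapr_yvar i k : xswapr i (yvar n.+1 k) = yvar n.+1 k.
Proof.
case: k => [|k] /=; first exact: rmorph0.
case: insubP => [j _ _|_] /=; last exact: rmorph0.
by rewrite msym_var tpermD // eq_lrshift.
Qed.

Lemma xswapr_xv i t : (i < n)%N -> (t <= n)%N -> xswapr i (xv t) =
  xv (if t == i then i.+1 else if t == i.+1 then i else t).
Proof.
move=> lt_i le_t; rewrite -xswaprE // xswap_var adjE // /xv; congr xvar.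
by apply: val_inj; rewrite /= transp_val // !inordK //; case: (t =P i); case: (t =P i.+1) => *; lia.
Qed.

Lemma xswapr_xvD i t : (i < n)%N -> (t <= n)%N -> t != i -> t != i.+1 -> xswapr i (xv t) = xv t.
Proof. by move=> lt_i le_t /negbTE ne /negbTE ne1; rewrite xswapr_xv // ne ne1. Qed.

Definition inner d : {ffun 'S_n.+1 -> R} := if d is d'.+1 then pipes d' else deltaf n R.

Lemma pipesE d : pipes d = prow (n - d) d (inner d).
Proof. by case: d. Qed.

(** Only x_t and u_c with t, c > i + 1 occur in [inner d]: x_i and x_(i+1) are absent, and u_i
    commutes with every factor down to the unit [deltaf], where both actions agree. *)
Lemma inner_fix i d : (i < n)%N -> (i.+1 < n.+1 - d)%N -> (d <= n)%N -> fmap (xswapr i) (inner d) = inner d /\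
  rhecke i (inner d) = hecke i (inner d).
Proof.
move=> lt_i; elim: d => [|d IHd] lt_id le_d.
  split; last exact: rhecke_delta.
  by apply/ffunP => w; rewrite !ffunE; exact: rmorph_nat.
have [IH1 IH2] := IHd (ltac:(lia)) (ltac:(lia)).
rewrite /= pipesE /prow rhecke_row ?hecke_row ?IH2; try lia.
split=> //; rewrite fmap_row ?IH1; last exact: xswapr_yvar.
by rewrite xswapr_xvD //; lia.
Qed.

Lemma fmap_xswapr i (phi : {ffun 'S_n.+1 -> R}) : (i < n)%N ->
  fmap (xswap (inord i)) phi = fmap (xswapr i) phi.
Proof. by move=> lt_i; apply/ffunP => w; rewrite !ffunE xswaprE. Qed.

(** The relation appears when the row i is put outside the row i + 1. It persists under the rows t <
    i, which commute with [rhecke i] and do not involve x_i and x_(i+1). *)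
Lemma pipes_isobaric i d : (i < n)%N -> (n - i <= d <= n)%N ->
  lincomb (xv i - xv i.+1) (xv i - xv i.+1) (pipes d) (rhecke i (pipes d)) =
  lincomb (1 - xv i.+1) (xv i - 1) (pipes d) (fmap (xswap (inord i)) (pipes d)).
Proof.
move=> lt_i; rewrite (fmap_xswapr _ lt_i); elim: d => [|d IHd] /andP[le1 le2]; first by lia.
have [le|lt] := leqP (n - i) d.
  have {IHd} := IHd (ltac:(lia)).
  rewrite (pipesE d.+1) /prow [inner d.+1]/= rhecke_row; try lia.
  rewrite fmap_row; last exact: xswapr_yvar.
  rewrite xswapr_xvD; try lia.
  by rewrite -!row_lincomb => ->.
have Ed : d = (n - i.+1)%N by lia.
have [E1 E2] := @inner_fix i d lt_i (ltac:(lia)) (ltac:(lia)).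
have lt_id : (i + d < n)%N by lia.
rewrite (pipesE d.+1) /prow [inner d.+1]/= pipesE /prow.
rewrite (_ : (n - d.+1 = i)%N); last by lia.
rewrite (_ : (n - d = i.+1)%N); last by lia.
apply: (isobaric_rows lt_id _ _ _ E1 E2); first exact: xswapr_yvar.
  by rewrite xswapr_xv ?eqxx // ltnW.
by rewrite xswapr_xv // gtn_eqF // eqxx.
Qed.

(** Both sides obey the same recursion. The value at the longest permutation stays a hypothesis
    here; [pipes_longest] reads it off from the tableau sums. *)
Lemma pipes_groth : pipes n (longest n.+1) = groth_longest n.+1 ->
  forall w, groth w = pipes n w.
Proof.
move=> base w; have [m] := ubnP (n.+1 * n.+1 - perm_length w).
elim: m w => // m IHm w lt_m.
have [->|/groth_pick[i asc_i ->]] := eqVneq w (longest n.+1).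
  by rewrite base groth_longestE.
have [lt_i wi] := andP (etrans (esym (ascentE w i)) asc_i); rewrite ltnS in lt_i.
rewrite IHm; last first.
  case/andP: asc_i => _ /eqP Ev; have := perm_length_le (swap_at w i); lia.
have Ei : i = inord i by apply: val_inj; rewrite /= inordK.
have Ei1 : ordS i = inord i.+1 by rewrite {1}Ei ordS_inord.
have neq_i : i != ordS i by rewrite Ei1 {1}Ei eq_inord //; lia.
apply: (mulfI (xvarB_neq0 neq_i)); rewrite isobaricE Ei1.
have Esw : swap_at w i = (transp n i * w)%g by rewrite /swap_at {1}Ei adjE.
have desc_i : pdesc i (swap_at w i).
  by rewrite /pdesc -Ei1 -Ei !swap_atE /adj tpermL tpermR.
have := lincomb_rhecke_pdesc desc_i (pipes_isobaric lt_i (ltac:(lia) : (n - i <= n <= n)%N)).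
have -> : (transp n i * swap_at w i)%g = w by rewrite Esw mulgA transpK mul1g.
by rewrite /xv -Ei1 -Ei.
Qed.

End PipeDreams.

(** * Set-valued Rothe tableaux *)

Lemma in_rothe n (w : 'S_n) (i j : 'I_n) :
  ((i, j) \in rothe w) = (j < w i)%N && (i < (w^-1)%g j)%N.
Proof.
rewrite inE /=; congr (_ && _); apply/existsP/idP => [[h /andP[lt_ih /eqP<-]]|lt_i].
  by rewrite permK.
by exists ((w^-1)%g j); rewrite lt_i permKV eqxx.
Qed.

Lemma set_min_leq n (B : {set 'I_n}) y : y \in B -> (set_min B <= y)%N.
Proof.
move=> By; rewrite /set_min; have := mem_index_enum y.
elim: (index_enum _) => // a r IHr; rewrite inE big_cons => /orP[/eqP<-|/IHr le_y].
  by rewrite By geq_minl.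
by case: ifP => // _; rewrite geq_min le_y orbT.
Qed.

Lemma set_leP n (A B : {set 'I_n}) : A != set0 -> B != set0 ->
  reflect (forall x y, x \in A -> y \in B -> (x <= y)%N) (set_le A B).
Proof.
move=> nzA nzB; rewrite /set_le /set_max /set_min.
apply: (iffP idP) => [le_AB x y Ax By | le_AB].
  apply: (leq_trans (leq_bigmax_cond x Ax)); apply: (leq_trans le_AB).
  exact: set_min_leq.
have [x Ax ->] : {x | x \in A & \max_(a in A) a = x}.
  by apply: eq_bigmax_cond; rewrite card_gt0.
apply: (big_ind (fun m => x <= m)%N) => [|a b xa xb|y By]; last exact: le_AB.
  exact: ltnW.
by rewrite leq_min xa.
Qed.

Lemma set_ltP n (A B : {set 'I_n}) : A != set0 -> B != set0 ->
  reflect (forall x y, x \in A -> y \in B -> (x < y)%N) (set_lt A B).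
Proof.
move=> nzA nzB; rewrite /set_lt /set_max /set_min.
apply: (iffP idP) => [le_AB x y Ax By | le_AB].
  apply: (leq_ltn_trans (leq_bigmax_cond x Ax)); apply: (leq_trans le_AB).
  exact: set_min_leq.
have [x Ax ->] : {x | x \in A & \max_(a in A) a = x}.
  by apply: eq_bigmax_cond; rewrite card_gt0.
apply: (big_ind (fun m => x < m)%N) => [|a b xa xb|y By]; last exact: le_AB.
  exact: ltn_ord.
by rewrite leq_min xa.
Qed.

Definition svrt_spec n (w : 'S_n) (T : filling n) : Prop :=
  [/\ forall b, (T b != set0) = (b \in rothe w),
      forall (i j k x y : 'I_n), (j < k)%N -> x \in T (i, k) -> y \in T (i, j) -> (x <= y)%N,
      forall (i h j x y : 'I_n), (i < h)%N -> x \in T (i, j) -> y \in T (h, j) -> (x < y)%N &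
      forall b (x : 'I_n), x \in T b -> (x <= b.1)%N].

Lemma SVRTP n (w : 'S_n) (T : filling n) : reflect (svrt_spec w T) (T \in SVRT w (@flag0 n)).
Proof.
have nz (A : {set 'I_n}) a : a \in A -> A != set0 by move=> Aa; apply/set0Pn; exists a.
rewrite inE; apply: (iffP andP) => [[/and3P[/forallP T1 T2 T3] /forallP T4] | [T1 T2 T3 T4]].
  have T1' b : (T b != set0) = (b \in rothe w) by move/eqP: (T1 b).
  split=> // [i j k x y lt_jk Tx Ty | i h j x y lt_ih Tx Ty | b x Tx].
  - move/forallP/(_ i)/forallP/(_ j)/forallP/(_ k)/implyP: T2.
    rewrite -!T1' lt_jk (nz _ _ Tx) (nz _ _ Ty) => /(_ isT).
    by move/(set_leP (nz _ _ Tx) (nz _ _ Ty)); apply.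
  - move/forallP/(_ i)/forallP/(_ h)/forallP/(_ j)/implyP: T3.
    rewrite -!T1' lt_ih (nz _ _ Tx) (nz _ _ Ty) => /(_ isT).
    by move/(set_ltP (nz _ _ Tx) (nz _ _ Ty)); apply.
  - by move/forallP/(_ x)/implyP: (T4 b); apply.
split; last first.
  by apply/forallP => b; apply/forallP => x; apply/implyP => Tx; apply: T4.
apply/and3P; split.
- by apply/forallP => b; rewrite T1.
- apply/forallP => i; apply/forallP => j; apply/forallP => k; apply/implyP.
  rewrite -!T1 => /and3P[nz1 nz2 lt_jk].
  by apply/(set_leP nz2 nz1) => x y; apply: T2.
- apply/forallP => i; apply/forallP => h; apply/forallP => j; apply/implyP.
  rewrite -!T1 => /and3P[nz1 nz2 lt_ih].
  by apply/(set_ltP nz1 nz2) => x y; apply: T3.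
Qed.

Definition tableau_formula n (w : 'S_n) : xypoly n :=
  \sum_(T in SVRT w (@flag0 n))
     (-1) ^+ (tableau_size w T - perm_length w)%N
     * \prod_(b in rothe w) \prod_(t in T b)
         oplus (xvar t) (yvar n (rothe_m w b + b.1.+1 - t.+1)%N).

(** By [rothe_m_depth], [b.2 + depth w b] encodes the index of y in the formula; [depth_transp]
    shows that this sum is unchanged when a column is moved. *)
Definition depth n (w : 'S_n) (b : 'I_n * 'I_n) : nat :=
  #|[set p : 'I_n | (p <= b.1)%N && (b.2 < w p)%N]|.

Definition entry_weight n (w : 'S_n) (b : 'I_n * 'I_n) (x : 'I_n) : xypoly n :=
  oplus (xvar x) (yvar n (b.2 + depth w b - x)%N).

(* Signs are distributed so that a box contributes 1 when it contains a single
   entry of weight 1, whence the product carries the sign (-1)^(|T| - |D(w)|). *)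
Definition box_weight n (w : 'S_n) (b : 'I_n * 'I_n) (B : {set 'I_n}) : xypoly n :=
  - \prod_(x in B) - entry_weight w b x.

(** * Sums over tableaux with restricted smallest entry, and their Hecke recursion *)

Section TableauSums.

Variable n : nat.
Local Notation R := (xypoly n.+1).
Implicit Types (w v : 'S_n.+1) (T : filling n.+1) (t c : nat) (i j k p q x y h : 'I_n.+1).

(** Columns of the diagram are less than [n], so c = n imposes no restriction on the entries t, and
    t = 0 with c = n gives all of [SVRT]. *)
Definition tab t c w T : bool :=
  (T \in SVRT w (@flag0 n.+1)) &&
  [forall b, forall x in T b, (t <= x)%N && ((x == t :> nat) ==> (b.2 < c)%N)].

Definition tweight w T : R := \prod_(b in rothe w) box_weight w b (T b).

Definition tsum t c w : R := \sum_(T | tab t c w T) tweight w T.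

Lemma tabP t c w T : reflect
  (svrt_spec w T /\
   forall b x, x \in T b -> (t <= x)%N /\ (x = t :> nat -> (b.2 < c)%N)) (tab t c w T).
Proof.
apply: (iffP andP) => [[/SVRTP sT /forallP T5]|[sT T5]]; split=> //.
- move=> b x Tx; move/forallP/(_ x)/implyP/(_ Tx)/andP: (T5 b) => [-> /implyP T6].
  by split=> // /eqP.
- exact/SVRTP.
- apply/forallP => b; apply/forallP => x; apply/implyP => Tx.
  by have [-> T6] := T5 b x Tx; apply/implyP => /eqP.
Qed.

Lemma svrt_box w T i j x : svrt_spec w T -> x \in T (i, j) ->
  (j < w i)%N /\ (i < (w^-1)%g j)%N.
Proof.
case=> T1 _ _ _ Tx; apply/andP; rewrite -in_rothe -T1; apply/set0Pn; by exists x.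
Qed.

Lemma svrt_entry w T i j : svrt_spec w T -> (j < w i)%N -> (i < (w^-1)%g j)%N -> exists x,
  x \in T (i, j).
Proof. by case=> T1 _ _ _ lt1 lt2; apply/set0Pn; rewrite T1 in_rothe lt1. Qed.

Section Step.

Variables (t c : nat) (w : 'S_n.+1).
Hypotheses (le_tc : (t <= c)%N) (lt_cn : (c < n)%N).
Hypothesis fix_w : forall i, (i < t)%N -> w i = i.

Local Notation C0 := (inord c : 'I_n.+1).
Local Notation C1 := (inord c.+1 : 'I_n.+1).
Local Notation p := ((w^-1)%g C1).
Local Notation q := ((w^-1)%g C0).

Let C0E : C0 = c :> nat. Proof. by rewrite inordK // ltnS ltnW. Qed.
Let C1E : C1 = c.+1 :> nat. Proof. by rewrite inordK. Qed.

Let winj i j : w i = w j :> nat -> i = j.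
Proof. by move/val_inj/perm_inj. Qed.

Let wp : w p = c.+1 :> nat. Proof. by rewrite permKV. Qed.
Let wq : w q = c :> nat. Proof. by rewrite permKV. Qed.

(** As [t] is the least entry, its box is the top of column c. If i were above p, the box (i, c + 1)
    would exist and also need the entry t, in a forbidden column; if i were below p, the box (p, c)
    would lie above. Hence i = p. *)
Lemma tab_entry_col T i x : tab t c.+1 w T -> x \in T (i, C0) -> x = t :> nat ->
  [/\ i = p, (p < q)%N & forall h, (h < p)%N -> (w h <= c)%N].
Proof.
move/tabP => [sT T5] Tx Ex; have [T1 T2 T3 T4] := sT.
have [lt_w lt_i] := svrt_box sT Tx; rewrite C0E in lt_w.
have noup h y : (h < i)%N -> y \notin T (h, C0).
  move=> lt_hi; apply/negP => Ty; have := T3 _ _ _ _ _ lt_hi Ty Tx.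
  by have [] := T5 _ _ Ty; lia.
have Ei : i = p.
  apply: winj; rewrite wp; apply/eqP; apply: contraT => ne.
  have [lt_ip|] := ltnP i p.
    have [|y Ty] := svrt_entry sT _ lt_ip; first by rewrite C1E; lia.
    have := T2 _ _ _ _ _ (_ : C0 < C1)%N Ty Tx; have [le_ty] := T5 _ _ Ty.
    by rewrite /= C0E C1E ltnn; lia.
  rewrite leq_eqVlt => /orP[/eqP/val_inj Ep|lt_pi]; first by rewrite -Ep wp eqxx in ne.
  have [||y Ty] := @svrt_entry _ _ p C0 sT; rewrite ?wp ?C0E //; first exact: ltn_trans lt_i.
  by have := noup _ y lt_pi; rewrite Ty.
split=> // [|h lt_hp]; first by rewrite -Ei.
rewrite leqNgt; apply/negP => lt_h.
have [||y Ty] := @svrt_entry _ _ h C0 sT; rewrite ?C0E //.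
  by apply: ltn_trans lt_i; rewrite Ei.
by have := noup h y; rewrite Ei Ty => /(_ lt_hp).
Qed.

Lemma tsum_step_same : ~ ((p < q)%N /\ forall h, (h < p)%N -> (w h <= c)%N) ->
  tsum t c.+1 w = tsum t c w.
Proof.
move=> bad; apply: eq_bigl => T; apply/idP/idP => Ttab.
  have /tabP[sT T5] := Ttab; apply/tabP; split=> // -[i j] x Tx.
  have [le_t T6] := T5 _ _ Tx; split=> // Ex; have /= := T6 Ex.
  rewrite ltnS leq_eqVlt => /orP[/eqP Ej|//].
  have EC : j = C0 by apply: val_inj; rewrite /= C0E.
  rewrite EC in Tx; have [_ lt_pq Hh] := tab_entry_col Ttab Tx Ex; by case: bad.
have /tabP[sT T5] := Ttab; apply/tabP; split=> // b x Tx.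
by have [le_t T6] := T5 _ _ Tx; split=> // /T6/leqW.
Qed.

Hypothesis lt_pq : (p < q)%N.
Hypothesis col_empty : forall h, (h < p)%N -> (w h <= c)%N.

Local Notation s := (transp n c).
Local Notation v := (w * s)%g.
Local Notation b0 := (p, C0).
Local Notation t0 := (inord t : 'I_n.+1).
Local Notation z := (oplus (xv n t) (yvar n.+1 (c - t).+1)).

Let t0E : t0 = t :> nat. Proof. by rewrite inordK //; lia. Qed.

Let le_tp : (t <= p)%N.
Proof.
rewrite leqNgt; apply/negP => /[dup] lt_pt /fix_w Ep.
by have := wp; rewrite {1}Ep; lia.
Qed.

Let b0D : b0 \in rothe w. Proof. by rewrite in_rothe wp C0E ltnSn. Qed.

Let s_val a : s a = (if a == c :> nat then c.+1 else if a == c.+1 :> nat then c else a) :> nat.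
Proof. exact: transp_val. Qed.

Let s_lt i j : (j < s i)%N = if j == c :> nat then (i == c :> nat) || (c.+1 < i)%N
  else if j == c.+1 :> nat then (c.+1 < i)%N else (j < i)%N.
Proof.
by rewrite s_val; case: (val j =P c) => /= ?; case: (val j =P c.+1) => /= ?;
  case: (val i =P c) => /= ?; case: (val i =P c.+1) => /= ?; lia.
Qed.

Let b0N : (p, C1) \notin rothe v.
Proof. by rewrite in_rothe permM permKV transpR C0E C1E ltnNge leqnSn. Qed.

Let wne h : (h < p)%N -> (w h < c)%N.
Proof.
move=> lt_h; rewrite ltn_neqAle col_empty // andbT; apply/eqP => E.
have Eh : h = q by apply: winj; rewrite E wq.
by rewrite Eh in lt_h; lia.
Qed.

(** No row above [p] has a value beyond c, so column c + 1 of D(w) is empty. In D(v) column c is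
    empty, and column c + 1 is column c of D(w) without its top box [b0]. *)
Lemma rothe_transp i j : ((i, j) \in rothe w) = ((i, j) == b0) || ((i, s j) \in rothe v).
Proof.
rewrite !in_rothe permM transpVE [s (s j)]tpermK.
have [-> | neC0] := eqVneq j C0.
  rewrite transpL xpair_eqE eqxx andbT s_lt C0E C1E (gtn_eqF (ltnSn c)) eqxx.
  have [-> | nep] := eqVneq i p; first by rewrite wp ltnSn lt_pq.
  rewrite /= andbC [RHS]andbC; congr (_ && _); rewrite [RHS]ltn_neqAle.
  case: (c.+1 =P w i :> nat) => //= E.
  by case/eqP: nep; apply: winj; rewrite wp.
rewrite xpair_eqE (negbTE neC0) andbF /=.
have [-> | neC1] := eqVneq j C1.
  rewrite transpR s_lt C0E C1E eqxx; case: (ltnP i p) => lt_i; last by rewrite !andbF.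
  by have := wne lt_i; rewrite !andbT => lt_w; lia.
have js : s j = j by rewrite /transp tpermD // eq_sym.
rewrite js s_lt; case: eqP => [E|_]; first by case/eqP: neC0; apply: val_inj; rewrite /= C0E.
by case: eqP => [E|_] //; case/eqP: neC1; apply: val_inj; rewrite /= C1E.
Qed.

Let colC1 i : (i, C1) \notin rothe w.
Proof.
rewrite in_rothe C1E; case: (ltnP i p) => lt_i; last by rewrite andbF.
by have := wne lt_i; rewrite andbT; lia.
Qed.

Let colC0 i : (i, C0) \notin rothe v.
Proof.
have := colC1 i; rewrite rothe_transp transpR negb_or; by case/andP.
Qed.

Let s_other j : j != C0 -> j != C1 -> s j = j.
Proof. by move=> ne0 ne1; rewrite /transp tpermD // eq_sym. Qed.

Let s_ltc j : (s j < c.+1)%N -> s j = C0 \/ (s j = j /\ (j < c)%N).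
Proof.
have [->|ne0] := eqVneq j C0; first by rewrite transpL C1E ltnn.
have [->|ne1] := eqVneq j C1; first by rewrite transpR; left.
rewrite (s_other ne0 ne1) ltnS leq_eqVlt => /orP[/eqP E|]; last by right.
by case/eqP: ne0; apply: val_inj; rewrite /= C0E.
Qed.

Let s_mono j k : (j < k)%N -> (j = C0 /\ k = C1) \/ (s j < s k)%N.
Proof.
move=> lt_jk; rewrite !s_val.
have [Ej|ne0] := eqVneq j C0; last first.
  right; have : (j != c :> nat) by rewrite -[X in _ != X]C0E.
  by case: (j =P c :> nat); case: (j =P c.+1 :> nat); case: (k =P c :> nat); case: (k =P c.+1 :> nat); lia.
have [->|ne1] := eqVneq k C1; first by left.
rewrite Ej in lt_jk *; right; have : (k != c.+1 :> nat) by rewrite -[X in _ != X]C1E.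
rewrite C0E eqxx; case: (k =P c.+1 :> nat) => // ?; rewrite C0E in lt_jk.
by case: (k =P c :> nat); lia.
Qed.

(** A box of column c moves one column to the right, and its depth drops by 1 because row [p], whose
    value becomes c, no longer counts. Boxes in other columns keep both numbers. *)
Lemma depth_transp i j : (i, j) \in rothe w -> (i, j) != b0 ->
  (j + depth w (i, j) = s j + depth v (i, s j))%N.
Proof.
have [-> | ne0] := eqVneq j C0 => Dij neb.
  have neip : i != p by move: neb; rewrite xpair_eqE eqxx andbT.
  have lt_pi : (p < i)%N.
    rewrite ltnNge; apply/negP; rewrite leq_eqVlt => /orP[/eqP/val_inj E|/wne lt_w].
      by rewrite E eqxx in neip.
    by move: Dij; rewrite in_rothe C0E; lia.
  rewrite transpL C0E C1E addSn -addnS; congr (_ + _)%N.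
  rewrite /depth (cardsD1 p) inE /= wp C0E ltnW // ltnSn add1n; congr _.+1.
  apply: eq_card => h; rewrite !inE /= permM s_lt ?C0E C1E (gtn_eqF (ltnSn c)) eqxx.
  rewrite andbCA; congr (_ && _); rewrite [RHS]ltn_neqAle; congr (_ && _).
  by rewrite -[in LHS](inj_eq (@perm_inj _ w)) -val_eqE /= wp eq_sym.
have ne1 : j != C1 by apply: contraTneq Dij => ->; apply: colC1.
rewrite s_other //; congr (_ + _)%N; apply: eq_card => h; rewrite !inE /= permM s_lt.
case: (j =P c :> nat) => [E|_]; first by case/eqP: ne0; apply: val_inj; rewrite /= C0E.
by case: (j =P c.+1 :> nat) => [E|_] //; case/eqP: ne1; apply: val_inj; rewrite /= C1E.
Qed.

Let zE : entry_weight w b0 t0 = z.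
Proof.
rewrite /entry_weight /xv.
suff -> : depth w b0 = 1%N by rewrite /= t0E C0E (_ : (c + 1 - t = (c - t).+1)%N) //; lia.
rewrite /depth (_ : [set _ | _] = [set p]) ?cards1 //; apply/setP => h; rewrite !inE /= C0E.
have [->|ne] := eqVneq h p; first by rewrite leqnn wp ltnSn.
case: (leqP h p) => //= le_h; apply: leq_gtF.
by apply: col_empty; rewrite ltn_neqAle ne.
Qed.

Lemma tsum_split_out : \sum_(T | tab t c.+1 w T && (t0 \notin T b0)) tweight w T = tsum t c w.
Proof.
apply: eq_bigl => T; apply/andP/idP => [[Ttab nt0]|Ttab].
  have /tabP[sT T5] := Ttab; apply/tabP; split=> // -[i j] x Tx.
  have [le_t T6] := T5 _ _ Tx; split=> // Ex; have /= := T6 Ex.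
  rewrite ltnS leq_eqVlt => /orP[/eqP Ej|//].
  have EC : j = C0 by apply: val_inj; rewrite /= C0E.
  rewrite EC in Tx; have [Ei _ _] := tab_entry_col Ttab Tx Ex.
  by case/negP: nt0; rewrite -Ei (_ : t0 = x) //; apply: val_inj; rewrite /= t0E.
have /tabP[sT T5] := Ttab; split.
  by apply/tabP; split=> // b x Tx; have [le_t T6] := T5 _ _ Tx; split=> // /T6/leqW.
by apply/negP => /T5[_]; rewrite /= t0E C0E ltnn => /(_ erefl).
Qed.

(** Adding [t] to [b0] is a bijection from [tab t c w]: this box is the top of its column and the
    end of its row, so the least entry fits there. The new entry contributes the factor -z. *)
Lemma tsum_split_more :
  \sum_(T | tab t c.+1 w T && (t0 \in T b0) && (T b0 != [set t0])) tweight w T = - z * tsum t c w.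
Proof.
pose h T : filling n.+1 := [ffun b => if b == b0 then t0 |: T b else T b].
pose h' T : filling n.+1 := [ffun b => if b == b0 then T b :\ t0 else T b].
rewrite (reindex_onto h h') /=; last first.
  move=> T /andP[/andP[_ Tt0] _]; apply/ffunP => b; rewrite !ffunE.
  by case: eqP => // ->; rewrite setD1K.
rewrite /tsum big_distrr /=; apply: eq_big => [T|T].
  apply/andP/idP => [[/andP[/andP[/tabP[[T1 T2 T3 T4] T5] _] neT]] /eqP hK | Ttab].
    have sub b x : x \in T b -> x \in h T b.
      by rewrite ffunE; case: eqP => // _ Tx; rewrite in_setU1 Tx orbT.
    have nt0 : t0 \notin T b0 by rewrite -hK ffunE eqxx setD11.
    apply/tabP; split; first split.
    - move=> b; rewrite -T1 ffunE; case: (b =P b0) => // ->.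
      have -> : T b0 != set0 by apply: contraNneq neT => T0; rewrite ffunE eqxx T0 setU0.
      by apply/esym/set0Pn; exists t0; exact: setU11.
    - by move=> i j k x y lt_jk /sub Tx /sub Ty; apply: T2 lt_jk Tx Ty.
    - by move=> i k j x y lt_jk /sub Tx /sub Ty; apply: T3 lt_jk Tx Ty.
    - by move=> b x /sub/T4.
    - move=> [i j] x Tx; have [le_t T6] := T5 _ _ (sub _ _ Tx); split=> // Ex.
      have /= := T6 Ex; rewrite ltnS leq_eqVlt => /orP[/eqP Ej|//].
      have EC : j = C0 by apply: val_inj; rewrite /= C0E.
      have hTtab : tab t c.+1 w (h T) by apply/tabP.
      have := sub _ _ Tx; rewrite EC => hTx.
      have [Ei _ _] := tab_entry_col hTtab hTx Ex.
      by case/negP: nt0; rewrite -Ei -EC (_ : t0 = x) //; apply: val_inj; rewrite /= t0E.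
  have /tabP[sT T5] := Ttab; have [T1 T2 T3 T4] := sT.
  have nt0 : t0 \notin T b0.
    by apply/negP => /T5[_]; rewrite /= t0E C0E ltnn => /(_ erefl).
  have hE i j x : x \in h T (i, j) -> [/\ i = p, j = C0 & x = t0] \/ x \in T (i, j).
    rewrite ffunE; case: eqP => [[-> ->]|_]; last by right.
    by rewrite in_setU1 => /orP[/eqP->|Tx]; [left|right].
  have [z0 Tz0] : exists z0, z0 \in T b0 by apply/set0Pn; rewrite T1.
  split; last first.
    apply/eqP/ffunP => b; rewrite !ffunE; case: eqP => // ->.
    by rewrite setU1K.
  apply/andP; split; first (apply/andP; split).
  - apply/tabP; split; first split.
    + move=> b; rewrite -T1 ffunE; case: (b =P b0) => // ->.
      by rewrite T1 b0D; apply/set0Pn; exists t0; exact: setU11.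
    + move=> i j k x y lt_jk /hE[[Ei Ek ->]|Tx] /hE[[Ei' Ej ->]|Ty].
      * by [].
      * by rewrite t0E; have [] := T5 _ _ Ty.
      * have [lt_k _] := svrt_box sT Tx; move: lt_k; rewrite Ei' wp ltnS leqNgt.
        by rewrite -C0E -Ej lt_jk.
      * exact: T2 Tx Ty.
    + move=> i k j x y lt_ik /hE[[Ei Ej ->]|Tx] /hE[[Ek Ej' ->]|Ty].
      * by rewrite Ei Ek ltnn in lt_ik.
      * rewrite Ei Ej in Ty lt_ik *; have := T3 _ _ _ _ _ lt_ik Tz0 Ty.
        by rewrite t0E; have [] := T5 _ _ Tz0; lia.
      * have [lt_c _] := svrt_box sT Tx; rewrite Ek in lt_ik.
        by have := wne lt_ik; rewrite Ej' C0E in lt_c; lia.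
      * exact: T3 Tx Ty.
    + by move=> [i j] x /hE[[-> _ ->]|/T4//]; rewrite t0E.
    + move=> [i j] x /hE[[_ -> ->]|Tx]; first by rewrite t0E C0E leqnn ltnSn.
      by have [le_t T6] := T5 _ _ Tx; split=> // /T6/leqW.
  - by rewrite ffunE eqxx setU11.
  - apply/eqP; rewrite ffunE eqxx => /setP/(_ z0); rewrite in_setU1 Tz0 orbT in_set1.
    by move/esym/eqP => E; rewrite E (negbTE nt0) in Tz0.
move=> /andP[/andP[_ neT] /eqP hK].
have nt0 : t0 \notin T b0 by rewrite -hK ffunE eqxx setD11.
rewrite /tweight (bigD1 b0) ?b0D //= [in RHS](bigD1 b0) ?b0D //= mulrA; congr (_ * _).
  by rewrite ffunE eqxx /box_weight big_setU1 //= zE !mulNr mulrN.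
by apply: eq_bigr => b /andP[_ neb]; rewrite ffunE (negbTE neb).
Qed.

(** When [b0] is exactly {t}, deleting it and moving column c to column c + 1 gives a tableau for
    [v]; by [depth_transp] all other weights are kept. *)
Lemma tsum_split_single :
  \sum_(T | tab t c.+1 w T && (t0 \in T b0) && (T b0 == [set t0])) tweight w T = z * tsum t c v.
Proof.
pose h T : filling n.+1 := [ffun b => if b == b0 then [set t0] else T (b.1, s b.2)].
pose h' T : filling n.+1 := [ffun b => if b == (p, C1) then set0 else T (b.1, s b.2)].
have sK j : s (s j) = j by exact: tpermK.
have ne10 : (C1 == C0) = false by rewrite -val_eqE /= C1E C0E gtn_eqF.
have hb0 T : h T b0 = [set t0] by rewrite ffunE eqxx.
have emp v0 T i j : svrt_spec v0 T -> (i, j) \notin rothe v0 -> T (i, j) = set0.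
  by case=> T1 _ _ _; rewrite -T1 negbK => /eqP.
rewrite (reindex_onto h h') /=; last first.
  move=> T /andP[/andP[/tabP[sT _] _] /eqP Tt0]; apply/ffunP => -[i j]; rewrite !ffunE /=.
  rewrite sK; case: eqP => [->//|neb]; case: eqP => [[Ei Ej]|_] //.
  by case: neb; rewrite Ei -[j]sK Ej transpR.
rewrite /tsum big_distrr /=; apply: eq_big => [T|T].
  rewrite hb0 eqxx set11 !andbT; apply/andP/idP => [[Ttab /eqP hK] | Ttab].
    have /tabP[sT T5] := Ttab; have [T1 T2 T3 T4] := sT.
    have Tb1 : T (p, C1) = set0 by rewrite -hK ffunE eqxx.
    have Tout i x : x \notin T (p, C1) by rewrite Tb1 inE.
    have TE i j : (i, j) != (p, C1) -> T (i, j) = h T (i, s j).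
      by move=> neb; rewrite -{1}hK ffunE (negbTE neb).
    have sub i j x : x \in T (i, j) -> x \in h T (i, s j).
      have [[-> ->]|neb] := eqVneq (i, j) (p, C1); first by rewrite Tb1 inE.
      by rewrite TE.
    have sv : forall b, (T b != set0) = (b \in rothe v).
      move=> [i j]; have [[-> ->]|neb] := eqVneq (i, j) (p, C1).
        by rewrite Tb1 eqxx (negbTE b0N).
      rewrite TE // T1 rothe_transp sK; case: eqP => // -[Ei Ej].
      by case/eqP: neb; rewrite Ei -[j]sK Ej transpL.
    apply/tabP; split; first split=> //.
    - move=> i j k x y lt_jk Tx Ty; have [[Ej Ek]|lt_s] := s_mono lt_jk.
        by have := sv (i, C0); rewrite (negbTE (colC0 i)) -Ej; case: set0Pn => // -[]; exists y.
      exact: T2 lt_s (sub _ _ _ Tx) (sub _ _ _ Ty).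
    - by move=> i k j x y lt_ik /sub Tx /sub Ty; apply: T3 lt_ik Tx Ty.
    - by move=> [i j] x /sub/T4.
    - move=> [i j] x Tx; have hTx := sub _ _ _ Tx; have [le_t T6] := T5 _ _ hTx; split=> // Ex.
      have [Es|[Ej lt_j]] := s_ltc (T6 Ex); last exact: lt_j.
      rewrite Es in hTx; have [Ei _ _] := tab_entry_col Ttab hTx Ex.
      by move: Tx; rewrite Ei -[j]sK Es transpL Tb1 inE.
  have /tabP[sT T5] := Ttab; have [T1 T2 T3 T4] := sT.
  have hE i j x : x \in h T (i, j) ->
      [/\ i = p, j = C0 & x = t0] \/ ((i, j) != b0 /\ x \in T (i, s j)).
    rewrite ffunE /=; case: eqP => [[-> ->]|_]; last by right.
    by rewrite in_set1 => /eqP->; left.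
  split; last first.
    apply/eqP/ffunP => -[i j]; rewrite !ffunE /= sK.
    case: eqP => [[-> ->]|neb]; first by rewrite (emp _ _ _ _ sT b0N).
    by case: eqP => // -[Ei Ej]; case: neb; rewrite Ei -[j]sK Ej transpL.
  apply/tabP; split; first split.
  - move=> [i j]; rewrite rothe_transp -T1 ffunE /=; case: ((i, j) =P b0) => //= _.
    by apply/set0Pn; exists t0; rewrite inE.
  - move=> i j k x y lt_jk /hE[[Ei Ek ->]|[_ Tx]] /hE[[Ei' Ej ->]|[_ Ty]].
    + by [].
    + by rewrite t0E; have [] := T5 _ _ Ty.
    + have [] := svrt_box sT Tx; rewrite Ei' permM permKV transpR C0E.
      have [[_ Ek]|] := s_mono lt_jk; first by rewrite Ek transpR C0E ltnn.
      by rewrite Ej transpL C1E; lia.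
    + have [[_ Ek]|lt_s] := s_mono lt_jk; last exact: T2 lt_s Tx Ty.
      by move: Tx; rewrite Ek transpR (emp _ _ _ _ sT (colC0 i)) inE.
  - move=> i k j x y lt_ik /hE[[Ei Ej ->]|[_ Tx]] /hE[[Ek Ej' ->]|[_ Ty]].
    + by rewrite Ei Ek ltnn in lt_ik.
    + move: Ty; rewrite Ej transpL => Ty; have [le_t T6] := T5 _ _ Ty.
      rewrite t0E ltn_neqAle le_t andbT; apply/eqP => E.
      by have := T6 (esym E); rewrite /= C1E; lia.
    + have [] := svrt_box sT Tx; rewrite Ej' transpL permM s_lt C1E (gtn_eqF (ltnSn c)) eqxx.
      by rewrite Ek in lt_ik; have := wne lt_ik; lia.
    + exact: T3 Tx Ty.
  - by move=> [i j] x /hE[[-> _ ->]|[_ /T4//]]; rewrite t0E.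
  - move=> [i j] x /hE[[_ -> ->]|[_ Tx]]; first by rewrite t0E C0E leqnn ltnSn.
    have [le_t T6] := T5 _ _ Tx; split=> // /T6 /= lt_s.
    by have [Es|[Ej lt_j]] := s_ltc (leqW lt_s); [rewrite Es C0E ltnn in lt_s | rewrite -Ej leqW].
move=> _; rewrite /tweight (bigD1 b0) ?b0D //=; congr (_ * _).
  by rewrite hb0 /box_weight big_set1 opprK zE.
pose f (b : 'I_n.+1 * 'I_n.+1) := (b.1, s b.2).
have fK : involutive f by case=> i j; rewrite /f /= sK.
rewrite [RHS](reindex_inj (inv_inj fK)) /=; apply: eq_big => [[i j]|[i j] /andP[Dij neb]].
  rewrite rothe_transp /f /=; case: eqP => [[-> ->]|_]; last by rewrite andbT.
  by rewrite transpL (negbTE b0N).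
rewrite ffunE (negbTE neb) /box_weight /f /=; congr (- _); apply: eq_bigr => x _.
by rewrite /entry_weight (depth_transp Dij neb).
Qed.

(** The action of [hfactor c z] at a descent: the three sums come from [b0] without [t], with [t]
    alone, and with [t] among other entries. *)
Lemma tsum_step_desc : tsum t c.+1 w = tsum t c w + z * (tsum t c v - tsum t c w).
Proof.
rewrite {1}/tsum (bigID (fun T : filling n.+1 => t0 \in T b0)) /= tsum_split_out.
rewrite (bigID (fun T : filling n.+1 => T b0 == [set t0])) /= tsum_split_single tsum_split_more.
by rewrite mulrBr mulNr addrC.
Qed.

End Step.
End TableauSums.

(** * Row products as tableau sums for 1432-avoiding permutations *)

Section PipesTableaux.

Variable n : nat.
Local Notation R := (xypoly n.+1).
Implicit Types (w v : 'S_n.+1) (T : filling n.+1) (t c k d : nat) (i j a b h : 'I_n.+1).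

Definition fixes_below t w := forall i, (i < t)%N -> w i = i.

(* The condition on patterns starting at position [t] weakens as [c] decreases:
   a transposition of the values [c] and [c + 1] can create such a pattern,
   but only one ending with the value [c + 1]. *)
Definition row_class t c w : Prop :=
  [/\ fixes_below t w,
      forall i1 i2 i3 i4, (t < i1)%N -> (i1 < i2)%N -> (i2 < i3)%N -> (i3 < i4)%N ->
        (w i1 < w i4)%N -> (w i4 < w i3)%N -> (w i3 < w i2)%N -> False &
      forall i1 i2 i3 i4, i1 = t :> nat -> (i1 < i2)%N -> (i2 < i3)%N -> (i3 < i4)%N ->
        (w i1 < w i4)%N -> (w i4 < w i3)%N -> (w i3 < w i2)%N -> (w i4 < c)%N -> False].

Lemma transp_small c a : (c < n)%N -> (transp n c a < c)%N = (a < c)%N.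
Proof.
by move=> lt_c; rewrite transp_val //; case: (a =P c :> nat) => ?; case: (a =P c.+1 :> nat) => ?; lia.
Qed.

Lemma transp_big c a : (c < n)%N -> (c.+1 < transp n c a)%N = (c.+1 < a)%N.
Proof.
by move=> lt_c; rewrite transp_val //; case: (a =P c :> nat) => ?; case: (a =P c.+1 :> nat) => ?; lia.
Qed.

Lemma transp_id c a : (c < n)%N -> (a < c)%N || (c.+1 < a)%N -> transp n c a = a.
Proof.
move=> lt_c ac; apply: val_inj; rewrite /= transp_val //.
by case: (a =P c :> nat) => ?; case: (a =P c.+1 :> nat) => ?; lia.
Qed.

Lemma fixes_transp t c w : (t <= c < n)%N -> fixes_below t w -> fixes_below t (w * transp n c)%g.
Proof. by move=> ? fw i lt_i; rewrite permM fw // transp_id //; lia. Qed.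

(** A new pattern must have the values c at [p] as its 1 and c + 1 at [q] as its 2. If [p] is beyond
    t, putting the position t in place of [p] gives a pattern of [w] that its class forbids; if [p]
    is t, the pattern ends with c + 1 and the class for c allows it. *)
Lemma row_class_step t c w : (t <= c < n)%N -> row_class t c.+1 w ->
    (forall h, (h < (w^-1)%g (inord c.+1))%N -> (w h <= c)%N) -> vdesc c w ->
  row_class t c (w * transp n c)%g.
Proof.
move=> le_c [K1 K2 K3] emp desc; set p := (w^-1)%g _ in emp; set q := (w^-1)%g (inord c).
have lt_c : (c < n)%N by lia.
have lt_pq : (p < q)%N by [].
have wp : w p = c.+1 :> nat by rewrite permKV inordK.
have wq : w q = c :> nat by rewrite permKV inordK // ltnS ltnW.
have le_tp : (t <= p)%N by rewrite leqNgt; apply/negP => /[dup] lt /K1 E; rewrite E in wp; lia.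
have vlt a b : (transp n c a < transp n c b)%N -> (a < b)%N \/ a = c.+1 :> nat /\ b = c :> nat.
  rewrite !transp_val //; case: (a =P c :> nat) => ?; case: (a =P c.+1 :> nat) => ?;
  by case: (b =P c :> nat) => ?; case: (b =P c.+1 :> nat) => ?; lia.
have wpE i : w i = c.+1 :> nat -> i = p :> nat by rewrite -wp => /val_inj/perm_inj->.
have wqE i : w i = c :> nat -> i = q :> nat by rewrite -wq => /val_inj/perm_inj->.
have main i1 i2 i3 i4 : (i1 < i2)%N -> (i2 < i3)%N -> (i3 < i4)%N ->
    ((w * transp n c)%g i1 < (w * transp n c)%g i4)%N ->
    ((w * transp n c)%g i4 < (w * transp n c)%g i3)%N ->
    ((w * transp n c)%g i3 < (w * transp n c)%g i2)%N ->
    [/\ (w i1 < w i4)%N, (w i4 < w i3)%N & (w i3 < w i2)%N] \/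
    [/\ i1 = p, i4 = q, (c < w i3)%N & (w i3 < w i2)%N].
  rewrite !permM => l12 l23 l34 /vlt[l14|[/wpE E1 /wqE E4]] /vlt[l43|[/wpE E4' /wqE E3]]
    /vlt[l32|[/wpE E3' /wqE E2]]; try (by left); try (by exfalso; lia).
  by right; split=> //; [exact: val_inj | exact: val_inj | rewrite -wq -(val_inj E4)].
split=> [|i1 i2 i3 i4 lt1 l12 l23 l34 v14 v43 v32|i1 i2 i3 i4 E1 l12 l23 l34 v14 v43 v32 v4].
- exact: fixes_transp.
- have [[]|[Ei1 Ei4 w3 w32]] := main _ _ _ _ l12 l23 l34 v14 v43 v32; first exact: K2.
  have lt_tn : (t < n.+1)%N by lia.
  have lt_tp : (Ordinal lt_tn < p)%N by rewrite -Ei1.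
  have wt : (w (Ordinal lt_tn) < c)%N.
    rewrite ltn_neqAle emp // andbT; by apply/eqP => /wqE E; lia.
  apply: (K3 (Ordinal lt_tn) i2 i3 i4) => //; rewrite ?Ei4 ?wq //.
  by rewrite -Ei1 in lt_tp; apply: ltn_trans l12.
have [[w14 w43 w32]|[_ Ei4 _ _]] := main _ _ _ _ l12 l23 l34 v14 v43 v32.
  apply: (K3 _ _ _ _ E1 l12 l23 l34 w14 w43 w32).
  by rewrite permM transp_small // in v4; apply: ltnW.
by move: v4; rewrite permM transp_small // Ei4 wq ltnn.
Qed.

(** The generators u_t, ..., u_(t+k-1) of the row each raise the value at position t by at most 1,
    so starting from t it reaches at most t + k. *)
Lemma row_vanish t k (x : R) (y : nat -> R) (phi : {ffun 'S_n.+1 -> R}) w : (t + k <= n)%N ->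
    (forall v, v (inord t) != inord t -> phi v = 0) -> (t + k < w (inord t))%N ->
  hrow y x t k phi w = 0.
Proof.
move=> + phi0; elim: k w => [|k IHk] w le_n lt_w.
  by apply: phi0; rewrite -val_eqE /= [X in _ != X]inordK //; lia.
rewrite /= !ffunE IHk; try lia.
case: ifP => _; rewrite ?IHk ?mulr0 ?subrr ?mulr0 ?addr0 //; try lia.
by rewrite permM transp_id; lia.
Qed.

Lemma row_vanish_fix t k (x : R) (y : nat -> R) (phi : {ffun 'S_n.+1 -> R}) w : (t + k <= n)%N ->
    (forall v, ~ fixes_below t v -> phi v = 0) -> ~ fixes_below t w ->
  hrow y x t k phi w = 0.
Proof.
move=> + phi0; elim: k w => [|k IHk] w le_n nfix; first exact: phi0.
have nfix' : ~ fixes_below t (w * transp n (t + k))%g.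
  move=> fw; apply: nfix; rewrite -[w](mulg_transpK (t + k)).
  by apply: fixes_transp => //; lia.
rewrite /= !ffunE !IHk //; try lia.
by rewrite subrr if_same mulr0 mulr0 addr0.
Qed.

Lemma inner_vanish d w : (d <= n.+1)%N -> ~ fixes_below (n.+1 - d) w -> inner n d w = 0.
Proof.
elim: d w => [|d IHd] w le_d nfix.
  rewrite ffunE; case: eqP => // E; case: nfix => i _; by rewrite E perm1.
rewrite /= pipesE /prow; rewrite subSS in nfix.
apply: row_vanish_fix => // [|v nv]; first by lia.
apply: IHd; first by lia.
by move=> fv; apply: nv => i lt_i; apply: fv; lia.
Qed.

(** An entry t would need a column below t, and these columns are empty because [w] fixes the values
    there. *)
Lemma tsum_row_end t w : (t <= n)%N -> fixes_below t w -> w (inord t) = inord t ->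
  tsum t t w = tsum t.+1 n w.
Proof.
move=> le_t fw wt; apply: eq_bigl => T; apply/tabP/tabP => -[sT T5]; split=> // -[i j] x Tx.
  have [le_x T6] := T5 _ _ Tx; have [lt_w lt_i] := svrt_box sT Tx; split.
    rewrite ltn_neqAle le_x andbT; apply/eqP => E; have /= lt_j := T6 (esym E).
    have wj : (w^-1)%g j = j by rewrite -{1}(fw j lt_j) permK.
    rewrite wj in lt_i; rewrite fw in lt_w; lia.
  by move=> _ /=; have := ltn_ord (w i); lia.
by have [lt_x T6] := T5 _ _ Tx; split=> [|E]; [exact: ltnW | lia].
Qed.

(** The diagram contains the box (t, t): its entries are at least t, at most t by the flag, and t is
    not allowed in column t. *)
Lemma tsum_vanish t w : (t <= n)%N -> fixes_below t w -> w (inord t) != inord t ->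
  tsum t t w = 0.
Proof.
move=> le_t fw; set t0 := inord t => ne.
have t0E : t0 = t :> nat by rewrite inordK.
apply: big1 => T /tabP[sT T5]; have [T1 T2 T3 T4] := sT.
have lt_w : (t0 < w t0)%N.
  rewrite ltn_neqAle eq_sym val_eqE ne leqNgt; apply/negP; rewrite t0E => lt_w.
  by have /perm_inj E := fw _ lt_w; rewrite E eqxx in ne.
have lt_v : (t0 < (w^-1)%g t0)%N.
  rewrite ltnNge leq_eqVlt; apply/negP => /orP[/eqP/val_inj E|].
    by rewrite -{1}E permKV eqxx in ne.
  by rewrite t0E => /[dup] lt /fw; rewrite permKV => E; rewrite -E t0E ltnn in lt.
have [x Tx] := svrt_entry sT lt_w lt_v.
have [le_x T6] := T5 _ _ Tx; have /= := T4 _ _ Tx; rewrite t0E => le_xt.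
by have /= := T6 (anti_leq (introT andP (conj le_xt le_x))); rewrite t0E ltnn.
Qed.

(** Induction along the row, adding the factor at c = t + k. There are three cases: no descent at c;
    a descent with no value beyond c before [p], where the tableau recursion applies; a descent with
    such a value, where the row terms vanish. *)
Lemma row_tsum t k w : (t + k <= n)%N ->
    (forall v, row_class t.+1 n v -> inner n (n - t) v = tsum t.+1 n v) ->
    row_class t (t + k) w ->
  prow t k (inner n (n - t)) w = tsum t (t + k) w.
Proof.
move=> + IHt; rewrite /prow; elim: k w => [|k IHk] w le_n Kw; have [K1 K2 K3] := Kw.
  rewrite addn0 in le_n *; have [wt|ne] := eqVneq (w (inord t)) (inord t); last first.
    rewrite tsum_vanish //= inner_vanish //; first by lia.
    move=> fw; case/eqP: ne; apply: fw.
    by rewrite inordK //; lia.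
  have fw : fixes_below t.+1 w.
    move=> i; rewrite ltnS leq_eqVlt => /orP[/eqP E|]; last exact: K1.
    by rewrite (_ : i = inord t) //; apply: val_inj; rewrite /= inordK.
  rewrite /= tsum_row_end //; apply: IHt; split=> // [i1 i2 i3 i4 lt1|i1 i2 i3 i4 E1].
    by apply: K2; apply: ltnW.
  by move=> l12 l23 l34 w14 w43 w32 _; apply: (K2 i1 i2 i3 i4) => //; rewrite E1.
set c := (t + k)%N; have lt_c : (c < n)%N by rewrite /c; lia.
have lt_tc : (t <= c)%N by rewrite leq_addr.
have Ec : (t + k.+1 = c.+1)%N by rewrite addnS.
rewrite Ec in Kw le_n *; rewrite /= -/c.
have Kc : row_class t c w.
  by case: Kw => ? ? K; split=> // ? ? ? ? ? ? ? ? ? ? ? /ltnW; apply: K; eassumption.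
have yE : (c - t).+1 = k.+1 by rewrite /c addKn.
move: (IHk) => IHk'.
set phi := hrow _ _ _ k _; rewrite -/phi -/c in IHk'.
have phiE v : row_class t c v -> phi v = tsum t c v by apply: IHk'; exact: ltnW.
rewrite !ffunE mul1r.
have p_val : w ((w^-1)%g (inord c.+1)) = c.+1 :> nat by rewrite permKV inordK.
have q_val : w ((w^-1)%g (inord c)) = c :> nat by rewrite permKV inordK // ltnS ltnW.
have [desc|ndesc] := boolP (vdesc c w); last first.
  rewrite mulr0 addr0 phiE // tsum_step_same //.
  by case=> lt_pq _; rewrite /vdesc lt_pq in ndesc.
have [/forallP emp|] := boolP [forall h : 'I_n.+1, (h < (w^-1)%g (inord c.+1))%N ==> (w h <= c)%N].
  have emp' h : (h < (w^-1)%g (inord c.+1))%N -> (w h <= c)%N by apply/implyP/emp.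
  rewrite (tsum_step_desc lt_tc lt_c K1 desc emp') yE !phiE //.
  by apply: row_class_step Kw emp' desc; rewrite lt_tc.
rewrite negb_forall => /existsP[i]; rewrite negb_imply -ltnNge => /andP[lt_ip lt_w].
rewrite [in RHS]tsum_step_same //; last first.
  by case=> _ /(_ _ lt_ip); rewrite leqNgt lt_w.
rewrite -phiE //.
set t0 : 'I_n.+1 := inord t; have t0E : t0 = t :> nat by rewrite inordK //; lia.
(* Otherwise the position t, [i] and the positions of the values c + 1 and c form a 1432 pattern
   whose last value c is below the bound c + 1 of the class. *)
have lt_wt : (c.+1 < w t0)%N.
  have neq j m : (j < (w^-1)%g (inord m))%N -> (m <= n)%N -> w j != m :> nat.
    move=> lt_j le_m; apply/eqP => E; move: lt_j.
    by rewrite (_ : inord m = w j) ?permK ?ltnn //; apply: val_inj; rewrite /= inordK.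
  have lt_c1 : (c.+1 < w i)%N by have := neq i c.+1 lt_ip; lia.
  rewrite ltnNge; apply/negP => le_wt.
  have ne_it : i != t0 by apply: contraTneq lt_c1 => ->; rewrite -leqNgt.
  have le_ti : (t <= i)%N.
    by rewrite leqNgt; apply/negP => /[dup] lt /K1 E; rewrite E in lt_c1; lia.
  have lt_ti : (t0 < i)%N by rewrite ltn_neqAle eq_sym ne_it t0E.
  have n1 := neq t0 c.+1 (ltn_trans lt_ti lt_ip) lt_c.
  have n2 := neq t0 c (ltn_trans (ltn_trans lt_ti lt_ip) desc) (ltnW lt_c).
  have [_ _ K3'] := Kw.
  apply: (K3' t0 i ((w^-1)%g (inord c.+1)) ((w^-1)%g (inord c))) => //.
  - by rewrite q_val; lia.
  - by rewrite p_val q_val.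
  - by rewrite p_val.
  - by rewrite q_val.
have van v : (c < v t0)%N -> phi v = 0.
  move=> lt_v; apply: row_vanish => [|u ne|]; [by lia| |exact: lt_v].
  apply: inner_vanish; first by lia.
  move=> fu; case/eqP: ne; apply: fu; rewrite -/t0 t0E; lia.
have -> : phi w = 0 by apply/van/ltnW.
have -> : phi (w * transp n c)%g = 0.
  by apply: van; rewrite permM; apply: ltnW; rewrite transp_big.
by rewrite subrr mulr0 addr0.
Qed.

Lemma inner_tsum d w : (d <= n.+1)%N -> row_class (n.+1 - d) n w ->
  inner n d w = tsum (n.+1 - d) n w.
Proof.
elim: d w => [|d IHd] w le_d Kw.
  have w1 : w = 1%g.
    by case: Kw => fw _ _; apply/permP => i; rewrite perm1 fw // subn0.
  rewrite w1 ffunE eqxx /tsum subn0.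
  have D0 (b : 'I_n.+1 * 'I_n.+1) : (b \in rothe (1%g : 'S_n.+1)) = false.
    by case: b => i j; rewrite in_rothe invg1 !perm1; lia.
  pose T0 : filling n.+1 := [ffun _ => set0].
  rewrite (big_pred1 T0) => [|T]; first by rewrite /tweight big_pred0.
  apply/idP/eqP => [/tabP[[T1 _ _ _] _]|->].
    by apply/ffunP => b; rewrite ffunE; apply/eqP; move: (T1 b); rewrite D0 => /negbFE.
  apply/tabP; split; first split=> [b|i j k x y _|i h j x y _|b x].
  - by rewrite ffunE eqxx D0.
  - by rewrite ffunE inE.
  - by rewrite ffunE inE.
  - by rewrite ffunE inE.
  by move=> b x; rewrite ffunE inE.
rewrite subSS in Kw *; have E : (n - d + d = n)%N by lia.
have Ed : (n - (n - d) = d)%N by lia.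
have IH v : row_class (n - d).+1 n v -> inner n (n - (n - d)) v = tsum (n - d).+1 n v.
  by rewrite Ed -subSn //; apply: IHd; exact: ltnW.
have le_E : (n - d + d <= n)%N by rewrite E.
rewrite -{2}E in Kw.
by have := row_tsum le_E IH Kw; rewrite Ed E /= pipesE.
Qed.

Lemma avoids_row_class w : avoids1432 w -> row_class 0 n w.
Proof.
move=> av; split=> // [i1 i2 i3 i4 _|i1 i2 i3 i4 _] l12 l23 l34 w14 w43 w32 => [|_];
  by apply: av; exists i1, i2, i3, i4.
Qed.

Lemma avoids_pipes w : avoids1432 w -> pipes n n w = tsum 0 n w.
Proof.
by move=> av; have := @inner_tsum n.+1 w (leqnn _); rewrite subnn; apply; apply: avoids_row_class.
Qed.

Lemma tab0E w T : tab 0 n w T = (T \in SVRT w (@flag0 n.+1)).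
Proof.
apply/tabP/SVRTP => [[]//|sT]; split=> // -[i j] x Tx; split=> // _ /=.
by have [lt_j _] := svrt_box sT Tx; have := ltn_ord (w i); lia.
Qed.

(** * The longest permutation and the passage to the original formula *)

Lemma avoids_longest : avoids1432 (longest n.+1).
Proof.
move=> [i1 [i2 [i3 [i4 [[l12 l23 l34]]]]]]; rewrite !permE /=.
by case=> ? _ _; have := ltn_ord i4; lia.
Qed.

Lemma card_ord_leq (a : 'I_n.+1) : #|[set h : 'I_n.+1 | (h <= a)%N]| = a.+1.
Proof.
rewrite -sum1dep_card -[RHS]card_ord -sum1_card.
by rewrite (big_ord_widen n.+1 (fun=> 1%N)) //; apply: ltn_ord.
Qed.

(** The columns of the staircase diagram start in the top row without gaps, so strict columns and
    the flag force the entry i in row i: the sum has a single term, the product [groth_longest]. *)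
Lemma pipes_longest : pipes n n (longest n.+1) = groth_longest n.+1.
Proof.
rewrite avoids_pipes; last exact: avoids_longest.
set w0 := longest n.+1.
have wE i : w0 i = (n - i)%N :> nat by rewrite permE /= subSS.
have vE i : (w0^-1)%g i = (n - i)%N :> nat.
  by rewrite -{2}[i](permKV w0) wE; have := ltn_ord ((w0^-1)%g i); lia.
have inD i j : ((i, j) \in rothe w0) = (i.+1 + j.+1 <= n.+1)%N.
  by rewrite in_rothe wE vE; have := ltn_ord i; have := ltn_ord j; lia.
pose T0 : filling n.+1 := [ffun b => if b \in rothe w0 then [set b.1] else set0].
rewrite /tsum (big_pred1 T0) => [|T]; last first.
  rewrite tab0E; apply/SVRTP/eqP => [sT|->].
    have [T1 T2 T3 T4] := sT.
    have ge i j x : x \in T (i, j) -> (i <= x)%N.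
      have [m] := ubnP (i : nat); elim: m i x => // m IHm i x lt_m Tx.
      have [/eqP i0|i_gt0] := posnP (i : nat); first by rewrite (eqP i0).
      have lt_i1 : (i.-1 < n.+1)%N by have := ltn_ord i; lia.
      have [lt_w lt_v] := svrt_box sT Tx.
      have [||y Ty] := @svrt_entry _ _ _ (Ordinal lt_i1) j sT.
      - by move: lt_w; rewrite !wE /=; lia.
      - by rewrite /=; lia.
      have /= := IHm _ _ (_ : (Ordinal lt_i1 < m)%N) Ty => /(_ (ltac:(simpl; lia))).
      by have := T3 (Ordinal lt_i1) i j _ _ (ltac:(simpl; lia)) Ty Tx; lia.
    apply/ffunP => b; rewrite ffunE; case: ifP => Db; last first.
      by apply/eqP; move: (T1 b); rewrite Db => /negbFE.
    have /set0Pn[x Tx] : T b != set0 by rewrite T1.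
    have TE y : y \in T b -> y = b.1.
      by case: b {Db Tx} => i j Ty; apply/val_inj/anti_leq; rewrite (ge _ _ _ Ty) (T4 _ _ Ty).
    apply/setP => y; rewrite in_set1; apply/idP/eqP => [/TE//|->].
    by rewrite -(TE x Tx).
  split.
  - by move=> b; rewrite ffunE; case: ifP; rewrite ?eqxx // -cards_eq0 cards1.
  - move=> i j k x y _; rewrite !ffunE; case: ifP; rewrite ?inE // => _ /eqP->.
    by case: ifP; rewrite ?inE // => _ /eqP->.
  - move=> i h j x y lt_ih; rewrite !ffunE; case: ifP; rewrite ?inE // => _ /eqP->.
    by case: ifP; rewrite ?inE // => _ /eqP->.
  - by move=> b x; rewrite ffunE; case: ifP; rewrite ?inE // => _ /eqP->.
rewrite /tweight /groth_longest; apply: eq_big => [[i j]|[i j] Db]; first exact: inD.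
rewrite ffunE Db /box_weight big_set1 opprK /entry_weight /=.
suff -> : depth w0 (i, j) = i.+1 by rewrite (_ : (j + i.+1 - i = j.+1)%N) //; lia.
rewrite /depth -[RHS]card_ord_leq; apply: eq_card => h; rewrite !inE /= wE.
by case: (leqP h i) => //= le_h; move: Db; rewrite inD; lia.
Qed.

Lemma perm_lengthE w : perm_length w = #|rothe w|.
Proof.
pose f (b : 'I_n.+1 * 'I_n.+1) := (b.1, w b.2).
have f_inj : injective f by move=> [a b] [c d] [-> /perm_inj->].
rewrite /perm_length -(card_imset _ f_inj); apply: eq_card => -[i j].
rewrite in_rothe -[j](permKV w) -[(i, _)]/(f (i, (w^-1)%g j)) (mem_imset _ _ f_inj) !inE /=.
by rewrite permKV andbC.
Qed.

(** [w] matches the positions up to i having values up to j with the values up to j having positions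
    up to i. The remaining ones among i + 1 positions and j + 1 values are counted by [depth] and
    [rothe_m]. *)
Lemma rothe_m_depth w (b : 'I_n.+1 * 'I_n.+1) : b \in rothe w -> (rothe_m w b + b.1.+1 = (b.2 + depth w b).+1)%N.
Proof.
case: b => i j Dij; have := Dij; rewrite in_rothe => /andP[lt_j lt_i] /=.
pose K := [set k : 'I_n.+1 | (k <= j)%N]; pose P := [set p : 'I_n.+1 | (p <= i)%N].
pose V := [set k : 'I_n.+1 | ((w^-1)%g k <= i)%N]; pose L := [set p | (w p <= j)%N].
have e1 : (#|K :&: V| + #|K :\: V| = j.+1)%N by rewrite cardsID card_ord_leq.
have e2 : (#|P :&: L| + #|P :\: L| = i.+1)%N by rewrite cardsID card_ord_leq.
have e3 : #|K :&: V| = #|P :&: L|.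
  rewrite -(card_imset (P :&: L) (@perm_inj _ w)); apply: eq_card => k.
  by rewrite -[k](permKV w) (mem_imset _ _ perm_inj) !inE permKV andbC.
have -> : rothe_m w (i, j) = #|K :\: V|.
  apply: eq_card => k; rewrite inE /= in_rothe !inE -ltnNge andbC [RHS]andbC.
  by case: (leqP k j) => //= le_k; rewrite (leq_ltn_trans le_k).
have -> : depth w (i, j) = #|P :\: L|.
  by apply: eq_card => p; rewrite !inE -ltnNge andbC.
lia.
Qed.

Lemma avoids_groth_formula w : avoids1432 w -> groth w = tableau_formula w.
Proof.
move=> av; rewrite (pipes_groth pipes_longest) avoids_pipes // /tableau_formula.
apply: eq_big => [T|T]; first exact: tab0E.
rewrite tab0E => /SVRTP[T1 _ _ _].
(* The boxes are nonempty, so the exponent is the sum of the [#|T b| - 1], which are the signs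
   inside [box_weight]. *)
rewrite perm_lengthE -sum1_card /tableau_size -sumnB; last first.
  by move=> b Db; rewrite card_gt0 T1.
rewrite expr_sum -big_split /=; apply: eq_bigr => b Db.
have : (0 < #|T b|)%N by rewrite card_gt0 T1.
rewrite /box_weight prodrN; case: #|_| => // m _.
rewrite subn1 exprS mulN1r !mulNr opprK; congr (_ * _); apply: eq_bigr => x _.
by rewrite rothe_m_depth // subSS.
Qed.

End PipesTableaux.

(** * Minimal weights below a set of rows *)

Section LoweringInjections.

Variable m : nat.
Local Notation I := 'I_m.
Implicit Types (D : {set I}) (f g : {ffun I -> I}) (mu : I -> nat).

(* The images of these functions are exactly the sets of size [#|D|] that lie below
   [D] in the Gale order. *)
Definition low_inj D f : bool :=
  [forall i in D, f i <= i]%N && [forall i in D, forall j in D, (f i == f j) ==> (i == j)].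

Lemma low_injP D f : reflect
  ((forall i, i \in D -> (f i <= i)%N) /\ {in D &, injective f}) (low_inj D f).
Proof.
apply: (iffP andP) => [[/forall_inP H1 /forall_inP H2]|[H1 H2]]; split=> //.
- by move=> i j Di Dj E; move/forall_inP: (H2 i Di) => /(_ j Dj); rewrite E eqxx => /eqP.
- exact/forall_inP.
- apply/forall_inP => i Di; apply/forall_inP => j Dj; apply/implyP => /eqP E.
  by apply/eqP; apply: H2.
Qed.

Definition cost mu D f : nat := (\sum_(i in D) mu (f i))%N.

Definition mincost mu D : nat :=
  cost mu D [arg min_(f < [ffun i => i] | low_inj D f) cost mu D f].

Lemma low_inj_id D : low_inj D [ffun i => i].
Proof. by apply/low_injP; split=> [i _|i j _ _]; rewrite !ffunE. Qed.

Lemma mincost_le mu D f : low_inj D f -> (mincost mu D <= cost mu D f)%N.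
Proof.
by rewrite /mincost; case: arg_minnP => [|g _ H /H //]; exact: low_inj_id.
Qed.

Lemma mincost_attained mu D : exists2 f, low_inj D f & mincost mu D = cost mu D f.
Proof.
rewrite /mincost; case: arg_minnP => [|g Hg _]; first exact: low_inj_id.
by exists g.
Qed.

Lemma eq_mincost mu mu' D : mu =1 mu' -> mincost mu D = mincost mu' D.
Proof.
move=> E; have costE f : cost mu D f = cost mu' D f by apply: eq_bigr => i _; rewrite E.
apply/eqP; rewrite eqn_leq; apply/andP; split.
  by have [f tf ->] := mincost_attained mu' D; rewrite -costE mincost_le.
by have [f tf ->] := mincost_attained mu D; rewrite costE mincost_le.
Qed.

Lemma mincost_initial mu (k : nat) (D : {set I}) :
  (forall i : I, (i \in D) = (i < k)%N) -> mincost mu D = (\sum_(i in D) mu i)%N.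
Proof.
move=> DE; have [f /low_injP[f_le f_inj] ->] := mincost_attained mu D.
have fD : f @: D = D.
  apply/eqP; rewrite eqEcard (card_in_imset f_inj) leqnn andbT.
  apply/subsetP => _ /imsetP[i Di ->]; rewrite DE; apply: leq_ltn_trans (f_le i Di) _.
  by rewrite -DE.
by rewrite -{2}fD (big_imset _ f_inj).
Qed.

Variables (r r1 : I).
Hypothesis r1E : r1 = r.+1 :> nat.
Local Notation s := (tperm r r1).

Let s_id i : i != r -> i != r1 -> s i = i.
Proof. by move=> ? ?; rewrite tpermD // eq_sym. Qed.

Let s_le (i x : I) : (x <= i)%N -> i != r -> (s x <= i)%N.
Proof.
by move=> + ne; have {ne} : (i != r :> nat) by []; case: tpermP => [->|->|_ _] //; lia.
Qed.

(** Following [f] by [s] keeps it lowering unless f r = r. In that case [r] and [r1] both lie in D,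
    and conjugation by [s] works. *)
Lemma mincost_swap_le mu D : (r \in D -> r1 \in D) ->
  (mincost (fun i => mu (s i)) D <= mincost mu D)%N.
Proof.
move=> rD; have [f /low_injP[f_le f_inj] ->] := mincost_attained mu D.
have [/andP[Dr /eqP fr]|nr] := boolP ((r \in D) && (f r == r)).
  have sD i : (s i \in D) = (i \in D).
    by case: (tpermP r r1 i) => [->|->|//]; rewrite Dr rD.
  have -> : cost mu D f = cost (fun i => mu (s i)) D [ffun i => s (f (s i))].
    rewrite /cost (reindex_inj (@perm_inj _ s)) /=; apply: eq_big => i; first exact: sD.
    by move=> _; rewrite ffunE tpermK.
  apply: mincost_le; apply/low_injP; split=> [i Di|i j Di Dj].
    rewrite ffunE; have [-> | ne] := eqVneq i r.
      rewrite tpermL; have Dr1 := rD Dr; have le1 := f_le _ Dr1.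
      have ne1 : f r1 != r.
        by apply/eqP => E; have := f_inj _ _ Dr1 Dr; rewrite fr E => /(_ erefl) /(congr1 val) /=; lia.
      by move: ne1 le1; case: tpermP => [->|->|_ /eqP]; rewrite -?val_eqE /=; lia.
    have [-> | ne1] := eqVneq i r1; first by rewrite tpermR fr tpermL.
    by rewrite (s_id ne ne1) s_le ?f_le.
  by rewrite !ffunE => /perm_inj /f_inj; rewrite !sD => /(_ Di Dj)/perm_inj.
have -> : cost mu D f = cost (fun i => mu (s i)) D [ffun i => s (f i)].
  by apply: eq_bigr => i _; rewrite ffunE tpermK.
apply: mincost_le; apply/low_injP; split=> [i Di|i j Di Dj]; rewrite !ffunE.
  have [Ei | ne] := eqVneq i r; last by rewrite s_le ?f_le.
  have := f_le _ Di; rewrite Ei => le_f; rewrite Ei in Di.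
  have nfr : f r != r by move: nr; rewrite Di.
  by move: nfr le_f; case: tpermP => [->|->|_ /eqP]; rewrite -?val_eqE /=; lia.
by move/perm_inj/f_inj => ->.
Qed.

Lemma mincost_swap mu D : (r \in D -> r1 \in D) ->
  mincost (fun i => mu (s i)) D = mincost mu D.
Proof.
move=> rD; apply/eqP; rewrite eqn_leq mincost_swap_le //=.
rewrite -(@eq_mincost (fun i => mu (s (s i)))) => [|i]; last by rewrite tpermK.
exact: (@mincost_swap_le (fun i => mu (s i)) D rD).
Qed.

Section Shift.

Variable D : {set I}.
Hypotheses (rD : r \in D) (r1D : r1 \notin D).

Let sD i : (i \in s @: D) = (s i \in D).
Proof. by rewrite -{1}[i](tpermK r r1) (mem_imset _ _ perm_inj). Qed.

Lemma mincost_shift_le mu : (mincost mu (s @: D) <= mincost mu D)%N.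
Proof.
have [f /low_injP[f_le f_inj] ->] := mincost_attained mu D.
have -> : cost mu D f = cost mu (s @: D) [ffun i => f (s i)].
  by rewrite /cost (big_imset _ (in2W perm_inj)) /=; apply: eq_bigr => i _; rewrite ffunE tpermK.
apply: mincost_le; apply/low_injP; split=> [i|i j]; rewrite !sD !ffunE => Di.
  apply: leq_trans (f_le _ Di) _; move: Di; case: tpermP => [->|->|//] Di.
    by rewrite (negbTE r1D) in Di.
  by rewrite r1E.
by move=> Dj /(f_inj _ _ Di Dj)/perm_inj.
Qed.

(** A lowering map of [s @: D] that fixes [r1] does not restrict to D; following it by [s] replaces
    the value [r1] by [r], at no greater cost as [mu r <= mu r1]. If [r] is a value too, the two are
    exchanged at equal cost. *)
Lemma mincost_shift mu : (mu r <= mu r1)%N -> mincost mu (s @: D) = mincost mu D.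
Proof.
move=> le_mu; apply/eqP; rewrite eqn_leq mincost_shift_le /=.
have [f /low_injP[f_le f_inj] ->] := mincost_attained mu (s @: D).
have r1D' : r1 \in s @: D by rewrite sD tpermR.
have inD i : i \in D -> s i \in s @: D by rewrite sD tpermK.
have costE (g : I -> I) : cost mu D [ffun i => g (f (s i))] = (\sum_(i in s @: D) mu (g (f i)))%N.
  by rewrite (big_imset _ (in2W perm_inj)) /=; apply: eq_bigr => i _; rewrite ffunE.
have inj (g : I -> I) : injective g -> {in D &, injective [ffun i => g (f (s i))]}.
  by move=> g_inj i j Di Dj; rewrite !ffunE => /g_inj /(f_inj _ _ (inD _ Di) (inD _ Dj))/perm_inj.
have other i : i \in D -> i != r -> s i = i.
  by move=> Di ne; rewrite s_id //; apply: contraNneq r1D => <-.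
have [fr1|nfr1] := eqVneq (f r1) r1; last first.
  have -> : cost mu (s @: D) f = cost mu D [ffun i => f (s i)] by rewrite (costE id).
  apply: mincost_le; apply/low_injP; split=> [i Di|]; last exact: (inj id).
  rewrite ffunE; have [->|ne] := eqVneq i r; last first.
    by have := inD _ Di; rewrite other // => /f_le.
  by rewrite tpermL; have := f_le _ r1D'; move: nfr1; rewrite -val_eqE /=; lia.
apply: leq_trans (_ : cost mu D [ffun i => s (f (s i))] <= _)%N.
  apply: mincost_le; apply/low_injP; split=> [i Di|]; last by apply: inj; exact: perm_inj.
  rewrite ffunE; have [->|ne] := eqVneq i r; first by rewrite tpermL fr1 tpermR.
  by have := inD _ Di; rewrite other // => /f_le le_f; apply: s_le.
rewrite costE /cost (bigD1 r1) //= [X in (_ <= X)%N](bigD1 r1) //= fr1 tpermR.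
have [/exists_inP[i1 /andP[Di1 ne1] /eqP fi1]|nex] :=
    boolP [exists i in [pred i | (i \in s @: D) && (i != r1)], f i == r].
  rewrite (bigD1 i1) ?Di1 //= [X in (_ <= _ + X)%N](bigD1 i1) ?Di1 //= fi1 tpermL.
  rewrite addnCA leq_add2l leq_add2l leq_eqVlt; apply/orP; left; apply/eqP.
  apply: eq_bigr => i /andP[/andP[Di ne] ne']; rewrite s_id //.
    by apply: contraNneq ne' => fi; rewrite -fi1 in fi; rewrite (f_inj _ _ Di Di1 fi).
  by apply: contraNneq ne => fi; rewrite -fr1 in fi; rewrite (f_inj _ _ Di r1D' fi).
apply: leq_add => //; rewrite leq_eqVlt; apply/orP; left; apply/eqP.
apply: eq_bigr => i /andP[Di ne]; rewrite s_id //.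
  by apply: contraNneq nex => fi; apply/exists_inP; exists i; rewrite ?inE ?Di ?fi.
by apply: contraNneq ne => fi; rewrite -fr1 in fi; rewrite (f_inj _ _ Di r1D' fi).
Qed.

End Shift.
End LoweringInjections.

(** * Weights in three tiers, for which a 1432 pattern is expensive *)

Section Tiers.

Variables (m : nat) (Dk : {set 'I_m}) (c : 'I_m).
Implicit Types (i p q : 'I_m) (f g : {ffun 'I_m -> 'I_m}).

Definition tier p : nat := if p \in Dk then 0 else if (p < c)%N then 1 else 2.

(** As p + 1 lies between 1 and m, the tiers fill disjoint intervals, and the weight is positive and
    injective. *)
Definition tier_weight p : nat := p.+1 + m * tier p.

Lemma tier_weight_lt p q : (tier p < tier q)%N -> (tier_weight p < tier_weight q)%N.
Proof. by rewrite /tier_weight; have := ltn_ord p; nia. Qed.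

Lemma tier_weight_inj : injective tier_weight.
Proof.
move=> p q E; have := @tier_weight_lt p q; have := @tier_weight_lt q p.
move: E; rewrite /tier_weight => E lt1 lt2; have Et : tier p = tier q by lia.
by apply: val_inj => /=; rewrite Et in E; lia.
Qed.

(** A value outside Dk costs more than m and one inside at most m, so a cheapest map has image Dk;
    comparing the sums of f i and i then makes the lowering map the identity on Dk. *)
Lemma tier_min_id f : c \in Dk -> low_inj Dk f -> (cost tier_weight Dk f <= mincost tier_weight Dk)%N ->
  f c = c.
Proof.
move=> cDk /low_injP[f_le f_inj] min_f.
have {min_f} : (\sum_(p in f @: Dk) tier_weight p <= \sum_(p in Dk) tier_weight p)%N.
  rewrite (big_imset _ f_inj) /=; apply: leq_trans min_f _.
  apply: leq_trans (mincost_le _ (low_inj_id Dk)) _.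
  by apply: leq_sum => i _; rewrite ffunE.
have cB : #|f @: Dk| = #|Dk| by rewrite card_in_imset.
set B := f @: Dk in cB *.
rewrite (big_setID Dk) /= [X in (_ <= X)%N](big_setID B) /= setIC leq_add2l => le_sum.
have cE : #|B :\: Dk| = #|Dk :\: B|.
  by apply/eqP; rewrite -(eqn_add2l #|B :&: Dk|) cardsID [B :&: Dk]setIC cardsID cB.
have le1 : (m.+1 * #|B :\: Dk| <= \sum_(p in B :\: Dk) tier_weight p)%N.
  rewrite mulnC -sum_nat_const; apply: leq_sum => p; rewrite inE => /andP[nDk _].
  by rewrite /tier_weight /tier (negbTE nDk); case: ifP => _; lia.
have le2 : (\sum_(p in Dk :\: B) tier_weight p <= m * #|Dk :\: B|)%N.
  rewrite mulnC -sum_nat_const; apply: leq_sum => p; rewrite inE => /andP[_ pDk].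
  by rewrite /tier_weight /tier pDk; have := ltn_ord p; lia.
have N0 : #|B :\: Dk| = 0%N by move: (leq_trans le1 (leq_trans le_sum le2)); rewrite cE; lia.
have BE : f @: Dk = Dk.
  by apply/eqP; rewrite -/B eqEcard cB leqnn andbT -setD_eq0 -cards_eq0 N0.
have E : (\sum_(i in Dk) f i = \sum_(i in Dk) i)%N.
  by rewrite -{2}BE (big_imset _ f_inj).
have leE i : i \in Dk -> (f i <= i ?= iff (f i == i))%N by move=> /f_le le_i; split.
by have [_] := leqif_sum leE; rewrite E eqxx => /esym/forall_inP/(_ c cDk)/eqP.
Qed.

(** If g c = c, some x < c is free because [a] is missing in Dj, and some i > c in Dj has its value
    beyond c and outside Dk because [b] is not in Dk. Sending i to x instead lowers the tier from 2
    to at most 1. *)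
Lemma tier_unattained (Dj : {set 'I_m}) (a b : 'I_m) f g :
    (a < c)%N -> (c < b)%N -> b \in Dj -> b \notin Dk -> c \in Dk -> a \notin Dj ->
    Dk \subset Dj ->
    low_inj Dk f -> (cost tier_weight Dk f <= mincost tier_weight Dk)%N ->
    low_inj Dj g -> (cost tier_weight Dj g <= mincost tier_weight Dj)%N ->
    {in Dj &, forall p q, (p < q)%N -> (g p < g q)%N} ->
  (g c < f c)%N.
Proof.
move=> lt_ac lt_cb bDj bDk cDk aDj sub_kj tf min_f tg min_g g_mono.
rewrite (tier_min_id cDk tf min_f) ltnNge; apply/negP => le_cg.
have /low_injP[g_le g_inj] := tg.
have cDj : c \in Dj by apply: (subsetP sub_kj).
have gc : g c = c by apply/val_inj/anti_leq; rewrite le_cg g_le.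
have g_hi i : i \in Dj -> (c < i)%N -> (c < g i)%N.
  by move=> Di lt_i; rewrite -{1}gc g_mono.
pose L := [set p : 'I_m | (p < c)%N].
(* Monotonicity keeps the values of the points from c on out of [L], so only points of Dj below c,
   all different from [a], map into it. *)
have [x xL xB] : exists2 x, x \in L & x \notin g @: Dj.
  apply/exists_inP; rewrite -[X in is_true X]negbK negb_exists_in; apply/negP => /forall_inP sub.
  have : (#|L| <= #|L :\ a|)%N.
    apply: leq_trans (leq_imset_card g _); apply/subset_leq_card/subsetP => p pL.
    have /imsetP[i Di Ep] : p \in g @: Dj by rewrite -[_ \in _]negbK sub.
    apply/imsetP; exists i => //; rewrite !inE; apply/andP; split.
      by apply: contraNneq aDj => <-.
    rewrite inE Ep in pL; case: ltngtP => // [lt_ci|/val_inj E].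
      by rewrite ltnNge ltnW ?g_hi in pL.
    by rewrite E gc ltnn in pL.
  by rewrite (cardsD1 a) inE lt_ac ltnn.
have [i [Di lt_ci gi]] : exists i, [/\ i \in Dj, (c < i)%N & g i \notin Dk].
  pose U := [set p : 'I_m | (c < p)%N].
  have : ~~ (g @: (Dj :&: U) \subset Dk :&: U).
    apply/negP => /subset_leq_card; rewrite card_in_imset; last first.
      by move=> p q /setIP[Dp _] /setIP[Dq _]; apply: g_inj.
    have : Dk :&: U \proper Dj :&: U.
      apply/properP; split; first exact: setSI.
      by exists b; rewrite !inE ?bDj ?lt_cb // (negbTE bDk).
    by move/proper_card; rewrite ltnNge => /negP nle /nle.
  case/subsetPn => y /imsetP[i /setIP[Di]]; rewrite inE => lt_i -> nin; exists i; split=> //.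
  by apply: contra nin => Dgi; rewrite !inE Dgi g_hi.
pose g' : {ffun 'I_m -> 'I_m} := [ffun p => if p == i then x else g p].
have lt_xc : (x < c)%N by rewrite inE in xL.
have tg' : low_inj Dj g'.
  apply/low_injP; split=> [p Dp|p q Dp Dq]; rewrite !ffunE.
    by case: eqP => [->|_]; [exact: ltnW (ltn_trans lt_xc lt_ci) | exact: g_le].
  case: eqP => [->|_]; case: eqP => [->|_] // E; last exact: g_inj.
    by case/negP: xB; rewrite E imset_f.
  by case/negP: xB; rewrite -E imset_f.
have := leq_trans min_g (mincost_le _ tg'); rewrite /cost (bigD1 i) //= [X in (_ <= X)%N](bigD1 i) //=.
have -> : (\sum_(p in Dj | p != i) tier_weight (g' p) = \sum_(p in Dj | p != i) tier_weight (g p))%N.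
  by apply: eq_bigr => p /andP[_ /negbTE ne]; rewrite ffunE ne.
rewrite leq_add2r ffunE eqxx leqNgt => /negP; apply; apply: tier_weight_lt.
have /ltnW := g_hi i Di lt_ci; rewrite /tier (negbTE gi) lt_xc leqNgt => /negbTE->.
by case: ifP.
Qed.

End Tiers.

(** * Orders of the double Grothendieck polynomials *)

Definition rcol n (w : 'S_n) (j : 'I_n) : {set 'I_n} := [set i | (i, j) \in rothe w].

(** For injective positive [mu], the order at X = 0 of [groth w] at y = 0, x_i = X^(mu i); see
    [groth_val]. *)
Definition lowest n (w : 'S_n) (mu : 'I_n -> nat) : nat :=
  (\sum_j mincost mu (rcol w j))%N.

Lemma first_ascent n (w : 'S_n) : w != longest n ->
  exists2 r, ascent w r & forall p : 'I_n, (p < r)%N -> (w r < w p)%N.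
Proof.
move=> /ascent_exists [i0 asc0]; case: (arg_minnP (@nat_of_ord n) asc0) => r asc_r min_r.
exists r => // p; have [m Em] : exists m, m = (r - p)%N by exists (r - p)%N.
elim: m p Em => [|m IHm] p Em lt_pr; first by lia.
have lt_p1 : (p.+1 < n)%N by have := ltn_ord r; lia.
have p1E : ordS p = p.+1 :> nat by rewrite ordSE.
have wp : (w (ordS p) < w p)%N.
  have : ~~ ascent w p by apply/negP => /min_r; lia.
  have ne : ordS p == p = false by apply/eqP => /(congr1 (@nat_of_ord n)); rewrite p1E; lia.
  by rewrite ascentE lt_p1 /= -leqNgt leq_eqVlt val_eqE (inj_eq perm_inj) ne.
have [E|ne] := eqVneq r (ordS p); first by rewrite E.
apply: ltn_trans wp; apply: IHm; rewrite p1E; first by lia.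
have : (r != ordS p :> nat) by []; lia.
Qed.

(** * Columns of the Rothe diagram under a swap at the first ascent *)

Section FirstAscent.

Variables (n : nat) (w : 'S_n) (r r1 : 'I_n).
Hypotheses (Er : ordS r = r1) (asc_r : ascent w r) (first_r : forall p : 'I_n, (p < r)%N -> (w r < w p)%N).
Implicit Types (i j : 'I_n) (mu : 'I_n -> nat).

Local Notation s := (tperm r r1).
Local Notation u := (swap_at w r).

Let lt_r : (r.+1 < n)%N. Proof. by move: asc_r; rewrite ascentE => /andP[]. Qed.
Let lt_w : (w r < w r1)%N. Proof. by move: asc_r; rewrite ascentE Er => /andP[]. Qed.
Let r1E : r1 = r.+1 :> nat. Proof. by rewrite -Er; exact: ordSE. Qed.
Let sr : s r = r1. Proof. exact: tpermL. Qed.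
Let sr1 : s r1 = r. Proof. exact: tpermR. Qed.
Let sK i : s (s i) = i. Proof. exact: tpermK. Qed.
Let s_id i : i != r -> i != r1 -> s i = i.
Proof. by move=> ? ?; rewrite tpermD // eq_sym. Qed.

Let in_u i j : (i \in rcol u j) = (j < w (s i))%N && (i < s ((w^-1)%g j))%N.
Proof. by rewrite inE in_rothe swap_atE /swap_at /adj Er invMg tpermV permM. Qed.

Let in_w i j : (i \in rcol w j) = (j < w i)%N && (i < (w^-1)%g j)%N.
Proof. by rewrite inE in_rothe. Qed.

Lemma rcol_closed j : r \in rcol w j -> r1 \in rcol w j.
Proof.
rewrite !in_w => /andP[lt_j lt_q]; rewrite (ltn_trans lt_j lt_w) /=.
rewrite r1E ltn_neqAle lt_q andbT -r1E; apply/eqP => /val_inj E.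
by have := ltn_trans lt_j lt_w; rewrite E permKV ltnn.
Qed.

Lemma rcol_swap j : j != w r -> rcol u j = s @: rcol w j.
Proof.
move=> nej; apply/setP => i; rewrite -[in RHS](sK i) (mem_imset _ _ perm_inj) in_u in_w.
have nq : (w^-1)%g j != r by apply: contraNneq nej => <-; rewrite permKV.
have [Eq|nq1] := eqVneq ((w^-1)%g j) r1.
  have Ej : j = w r1 by rewrite -Eq permKV.
  rewrite Eq sr1 Ej; have [->|ne] := eqVneq i r; first by rewrite sr !ltnn andbF.
  have [->|ne1] := eqVneq i r1; first by rewrite sr1 ltnNge ltnW.
  rewrite s_id // r1E; congr (_ && _); have : (i != r :> nat) by [].
  by lia.
rewrite [s ((w^-1)%g j)]s_id //; congr (_ && _).
have : ((w^-1)%g j != r :> nat) && ((w^-1)%g j != r1 :> nat) by apply/andP; split.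
by have [->|ne] := eqVneq i r; [rewrite sr | have [->|ne1] := eqVneq i r1; rewrite ?sr1 ?s_id //];
  rewrite r1E; lia.
Qed.

Lemma in_rcol_wr i : (i \in rcol w (w r)) = (i < r)%N.
Proof. by rewrite in_w permK andbC; case: ltnP => // /first_r->. Qed.

Lemma in_rcol_swap_wr i : (i \in rcol u (w r)) = (i < r.+1)%N.
Proof.
rewrite in_u permK sr r1E andbC; case: ltnP => // le_i /=.
have [->|ne] := eqVneq i r; first by rewrite sr.
rewrite s_id ?first_r //; first by rewrite ltn_neqAle ne.
by apply: contraTneq le_i => ->; rewrite r1E ltnn.
Qed.

Lemma mincost_rcol_sym mu j : mincost (fun i => mu (s i)) (rcol w j) = mincost mu (rcol w j).
Proof. by apply: mincost_swap => //; exact: rcol_closed. Qed.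

(** By [rcol_closed] the column of [w] contains both [r] and [r1], neither, or only [r1]. In the
    first two cases it agrees with the column of [u] and its cost is symmetric; in the third it is
    the shift of the column of [u]. *)
Lemma mincost_rcol mu j : j != w r -> (mu r <= mu r1)%N ->
  mincost mu (rcol u j) = mincost mu (rcol w j) /\
  (mincost mu (rcol u j) <= mincost (fun i => mu (s i)) (rcol u j))%N.
Proof.
move=> nej le_mu; have := rcol_swap nej.
have Dw : rcol w j = s @: (s @: rcol w j).
  by rewrite -imset_comp -[LHS]imset_id; apply: eq_imset => i /=; rewrite sK.
have [r1D|nr1] := boolP (r1 \in rcol w j); have [rD|nr] := boolP (r \in rcol w j); last first.
- move=> Du; suff E : rcol u j = rcol w j by rewrite E mincost_rcol_sym.
  rewrite Du; apply/setP => i; rewrite -{1}(sK i) (mem_imset _ _ perm_inj).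
  by case: (tpermP r r1 i) => [->|->|//]; rewrite (negbTE nr) (negbTE nr1).
- by rewrite rcol_closed in nr1.
- move: (rcol u j) => U Du; have Du' : rcol w j = s @: U by rewrite Du.
  have rU : r \in U by rewrite Du; apply/imsetP; exists r1; rewrite ?sr1.
  have r1U : r1 \notin U.
    by rewrite Du; apply/imsetP => -[x Dx E]; rewrite -(sK x) -E sr1 (negbTE nr) in Dx.
  have E : mincost mu U = mincost mu (rcol w j).
    by rewrite Du' -(mincost_shift r1E rU r1U le_mu).
  rewrite E; split=> //.
  have := mincost_shift_le r1E r1U (fun i => mu (s i)).
  by rewrite -Du' mincost_rcol_sym.
move=> Du; suff E : rcol u j = rcol w j by rewrite E mincost_rcol_sym.
rewrite Du; apply/setP => i; rewrite -{1}(sK i) (mem_imset _ _ perm_inj).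
by case: (tpermP r r1 i) => [->|->|//]; rewrite rD r1D.
Qed.

Lemma lowest_sym mu : lowest w (fun i => mu (s i)) = lowest w mu.
Proof. by apply: eq_bigr => j _; rewrite mincost_rcol_sym. Qed.

Lemma mincost_rcol_wr mu : mincost mu (rcol w (w r)) = (\sum_(i < n | (i < r)%N) mu i)%N.
Proof. by rewrite (mincost_initial _ in_rcol_wr); apply: eq_bigl => i; rewrite in_rcol_wr. Qed.

Lemma mincost_rcol_swap_wr mu :
  mincost mu (rcol u (w r)) = ((\sum_(i < n | (i < r)%N) mu i) + mu r)%N.
Proof.
rewrite (mincost_initial _ in_rcol_swap_wr) (bigD1 r) /=; last by rewrite in_rcol_swap_wr.
rewrite addnC; congr (_ + _)%N; apply: eq_bigl => i; rewrite in_rcol_swap_wr ltnS.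
by rewrite andbC [RHS]ltn_neqAle.
Qed.

(** Only column [w r] changes its cost: it grows from the rows before [r] to the rows up to [r]. *)
Lemma lowest_swap mu : (mu r <= mu r1)%N -> lowest u mu = (lowest w mu + mu r)%N.
Proof.
move=> le_mu; rewrite /lowest [LHS](bigD1 (w r)) // [X in (X + _)%N = _]mincost_rcol_swap_wr.
rewrite [in RHS](bigD1 (w r)) //.
rewrite [X in _ = (X + _ + _)%N](mincost_rcol_wr mu).
rewrite [RHS]addnAC.
congr (_ + _)%N.
by apply: eq_bigr => j /= nej; have [] := mincost_rcol nej le_mu.
Qed.

(** Column [w r] pays [mu r1] instead of the smaller [mu r], and no other column gets cheaper. *)
Lemma lowest_swap_lt mu : (mu r < mu r1)%N ->
  (lowest u mu < lowest u (fun i => mu (s i)))%N.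
Proof.
move=> lt_mu; rewrite /lowest (bigD1 (w r)) // [X in (_ < X)%N](bigD1 (w r)) //.
rewrite -addSn; apply: leq_add; last first.
  by apply: leq_sum => j /= nej; have [] := mincost_rcol nej (ltnW lt_mu).
rewrite (mincost_rcol_swap_wr mu) (mincost_rcol_swap_wr (fun i => mu (s i))) sr -addnS.
apply: leq_add => //; rewrite leq_eqVlt; apply/orP; left; apply/eqP.
by apply: eq_bigr => i lt_i; rewrite s_id //; apply: contraTneq lt_i => ->; rewrite ?r1E; lia.
Qed.

End FirstAscent.

(** * Orders at X = 0 under a monomial specialization *)

Section Valuation.

Variable n : nat.
Implicit Types (w : 'S_n) (mu : 'I_n -> nat) (f : xypoly n).

Definition xpow mu (k : 'I_(n + n)) : {poly int} :=
  if split k is inl i then 'X^(mu i) else 0.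

Definition xeval mu : {rmorphism xypoly n -> {poly int}} := mmap (@polyC int) (xpow mu).

Lemma xevalX mu k : xeval mu 'X_k = xpow mu k.
Proof. by rewrite /xeval /= mmapX mmap1U. Qed.

Lemma xeval_xvar mu i : xeval mu (xvar i) = 'X^(mu i).
Proof. by rewrite xevalX /xpow (unsplitK (inl _ i)). Qed.

Lemma xeval_yvar mu k : xeval mu (yvar n k) = 0.
Proof.
case: k => [|k] /=; first exact: rmorph0.
case: insubP => [j _ _|_] /=; last exact: rmorph0.
by rewrite xevalX /xpow (unsplitK (inr _ j)).
Qed.

Lemma xeval_oplus mu i k : xeval mu (oplus (xvar i) (yvar n k)) = 'X^(mu i).
Proof. by rewrite /oplus rmorphB rmorphD rmorphM xeval_xvar xeval_yvar mulr0 subr0 addr0. Qed.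

Lemma xeval_xswap mu r f : xeval mu (xswap r f) = xeval (fun i => mu (adj r i)) f.
Proof.
pose P g := xeval mu (xswap r g) = xeval (fun i => mu (adj r i)) g.
have P1 : P 1 by rewrite /P xswap1 !rmorph1.
have PM g h : P g -> P h -> P (g * h) by rewrite /P xswapM !rmorphM => -> ->.
have PX k : P 'X_k.
  rewrite /P /xswap msym_var !xevalX /xpow -[k]splitK; case: (split k) => j /=.
    rewrite -(inj_tperm _ _ _ (@lshift_inj _ _)).
    by rewrite (unsplitK (inl _ j)) (unsplitK (inl _ (adj r j))).
  by rewrite tpermD ?eq_lrshift // !(unsplitK (inr _ j)).
elim/mpolyind: f => [|c m p _ _ IHp]; first by rewrite /xswap msym0 !rmorph0.
rewrite /xswap msymD msymZ !rmorphD /= !mmapZ; congr (_ * _ + _); last exact: IHp.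
change (P 'X_[m]); rewrite (mpolyXE_id _ m); apply: (big_ind P P1 PM) => k _.
by elim: (m k) => [|e IHe]; rewrite ?expr0 // exprS; apply: PM.
Qed.

(* [p] has order [a] at 0; the factor [q1] avoids division by units of the local ring. *)
Definition has_val (p : {poly int}) (a : nat) : Prop :=
  exists q1 q2 : {poly int}, [/\ q1.[0] != 0, q2.[0] != 0 & q1 * p = 'X^a * q2].

Lemma horner0Xn (k : nat) : (0 < k)%N -> ('X^k : {poly int}).[0] = 0.
Proof. by move=> k_gt0; rewrite hornerXn expr0n gtn_eqF. Qed.

(** The term of [f] has strictly smaller order than that of [f'] and so determines the order of the
    right-hand side; dividing by X^b - X^c, of order b, leaves the order a. *)
Lemma has_val_isobaric (g f f' : {poly int}) (a a' b c : nat) :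
    (0 < b)%N -> (b < c)%N -> (a + b < a')%N ->
    ('X^b - 'X^c) * g = (1 - 'X^c) * f - (1 - 'X^b) * f' ->
  has_val f (a + b) -> has_val f' a' -> has_val g a.
Proof.
move=> b_gt0 lt_bc lt_a E [q1 [q2 [nz1 nz2 Ef]]] [q1' [q2' [nz1' nz2' Ef']]].
exists (q1 * q1' * (1 - 'X^(c - b))).
exists ((1 - 'X^c) * q1' * q2 - (1 - 'X^b) * q1 * q2' * 'X^(a' - (a + b))); split.
- by rewrite !hornerM hornerD hornerN horner0Xn ?subn_gt0 // hornerC subr0 mulr1 mulf_neq0.
- rewrite hornerD hornerN !hornerM !hornerD !hornerN !horner0Xn ?subn_gt0 // ?(ltn_trans b_gt0) //.
  by rewrite !hornerC !subr0 mulr0 subr0 mul1r mulf_neq0.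
have nzX : 'X^b != 0 :> {poly int} by rewrite expf_neq0 ?polyX_eq0.
apply: (mulfI nzX).
transitivity (q1 * q1' * (('X^b - 'X^c) * g)).
  have -> : 'X^c = 'X^b * 'X^(c - b) :> {poly int} by rewrite -exprD subnKC // ltnW.
  by ring.
rewrite E.
transitivity ((1 - 'X^c) * q1' * (q1 * f) - (1 - 'X^b) * q1 * (q1' * f')); first by ring.
rewrite Ef Ef'.
have -> : 'X^a' = 'X^a * 'X^b * 'X^(a' - (a + b)) :> {poly int}.
  by rewrite -!exprD subnKC // ltnW.
by rewrite exprD; ring.
Qed.

Lemma lowest_longest mu :
  lowest (longest n) mu = (\sum_(p : 'I_n * 'I_n | (p.1.+1 + p.2.+1 <= n)%N) mu p.1)%N.
Proof.
have wE i : longest n i = (n - i.+1)%N :> nat by rewrite permE.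
have vE j : ((longest n)^-1)%g j = (n - j.+1)%N :> nat.
  by rewrite -{2}[j](permKV (longest n)) wE; have := ltn_ord (((longest n)^-1)%g j); lia.
have colE j i : (i \in rcol (longest n) j) = (i < n - j.+1)%N.
  by rewrite inE in_rothe wE vE; have := ltn_ord i; have := ltn_ord j; lia.
rewrite /lowest -(pair_big_dep xpredT (fun i j : 'I_n => (i.+1 + j.+1 <= n)%N) (fun i _ => mu i)) /=.
rewrite [RHS](exchange_big_dep xpredT) //=; apply: eq_bigr => j _.
rewrite (mincost_initial _ (colE j)); apply: eq_bigl => i; rewrite colE.
by have := ltn_ord j; lia.
Qed.

(** Induction along first ascents, with the induction hypothesis used for [mu] and for [mu] composed
    with the transposition; [lowest_swap_lt] rules out cancellation. *)
Lemma groth_val w mu : injective mu -> (forall i, (0 < mu i)%N) ->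
  has_val (xeval mu (groth w)) (lowest w mu).
Proof.
have [m] := ubnP (n * n - perm_length w); elim: m w mu => // m IHm w mu lt_m mu_inj mu_gt0.
have [->|neq_w] := eqVneq w (longest n).
  exists 1, 1; rewrite hornerE oner_eq0; split=> //; rewrite mul1r mulr1 groth_longestE lowest_longest.
  by rewrite rmorph_prod expr_sum; apply: eq_bigr => p _; exact: xeval_oplus.
have [r asc_r first_r] := first_ascent neq_w.
have [lt_r lt_w] := andP (etrans (esym (ascentE w r)) asc_r).
have [r1 Er1] : exists r1, r1 = ordS r by exists (ordS r).
have r1E : r1 = r.+1 :> nat by rewrite Er1 ordSE.
have ne_r : r != r1 by rewrite -val_eqE /= r1E; lia.
have Esym mu' : xeval mu' (groth w) = xeval (fun i => mu' (tperm r r1 i)) (groth w).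
  rewrite (groth_ascent asc_r) -{1}xswap_isobaric ?xeval_xswap -?Er1 //.
  by rewrite Er1.
(* [groth w] and [lowest w] are both symmetric in [r] and [r1], so [r] may be taken as the lighter
   of the two. *)
wlog lt_mu : mu mu_inj mu_gt0 / (mu r < mu r1)%N.
  move=> main; have [|le_mu] := ltnP (mu r) (mu r1); first exact: main.
  rewrite Esym -(lowest_sym (esym Er1) asc_r).
  apply: main => [|i|]; [by move=> i j /mu_inj/perm_inj|exact: mu_gt0|].
  rewrite tpermL tpermR ltn_neqAle le_mu andbT (inj_eq mu_inj) eq_sym.
  done.
have lt_len : (n * n - perm_length (swap_at w r) < m)%N.
  by case/andP: asc_r => _ /eqP Ev; have := perm_length_le (swap_at w r); lia.
have mu'_inj : injective (fun i => mu (tperm r r1 i)) by move=> i j /mu_inj/perm_inj.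
have V := IHm _ mu lt_len mu_inj mu_gt0.
have V' := IHm _ _ lt_len mu'_inj (fun i => mu_gt0 _).
rewrite (lowest_swap (esym Er1) asc_r first_r (ltnW lt_mu)) in V.
have lt_low := lowest_swap_lt (esym Er1) asc_r first_r lt_mu.
rewrite (lowest_swap (esym Er1) asc_r first_r (ltnW lt_mu)) in lt_low.
apply: has_val_isobaric (mu_gt0 r) lt_mu lt_low _ V V'.
rewrite (groth_ascent asc_r).
have := congr1 (xeval mu) (isobaricE r (groth (swap_at w r))).
rewrite !(rmorphM, rmorphB, rmorph1) !xeval_xvar xeval_xswap -Er1 => ->.
by rewrite Er1.
Qed.

End Valuation.

(** * Orders of tableau terms for a permutation containing 1432 *)

Section PatternTableaux.

Variables (n : nat) (w : 'S_n).
Implicit Types (mu : 'I_n -> nat) (T : filling n) (i j : 'I_n).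

Definition entry_sum mu T : nat := (\sum_(b in rothe w) \sum_(x in T b) mu x)%N.

(** One entry chosen in each box of column [j], with default [i] off the diagram. The flag and
    strict columns make it a lowering injection. *)
Definition column T j : {ffun 'I_n -> 'I_n} := [ffun i => odflt i [pick x in T (i, j)]].

Lemma column_in T i j : svrt_spec w T -> i \in rcol w j -> column T j i \in T (i, j).
Proof.
case=> T1 _ _ _; rewrite inE -T1 => /set0Pn[x Tx].
by rewrite ffunE; case: pickP => [//|/(_ x)]; rewrite Tx.
Qed.

Lemma column_mono T j : svrt_spec w T ->
  {in rcol w j &, forall p q : 'I_n, (p < q)%N -> (column T j p < column T j q)%N}.
Proof.
move=> sT p q Dp Dq lt_pq; have [_ _ T3 _] := sT.
exact: T3 lt_pq (column_in sT Dp) (column_in sT Dq).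
Qed.

Lemma column_low_inj T j : svrt_spec w T -> low_inj (rcol w j) (column T j).
Proof.
move=> sT; have [_ _ _ T4] := sT; apply/low_injP; split=> [i Di|p q Dp Dq E].
  exact: T4 (column_in sT Di).
case: (ltngtP p q) => [lt|lt|/val_inj//].
  by have := column_mono sT Dp Dq lt; rewrite E ltnn.
by have := column_mono sT Dq Dp lt; rewrite E ltnn.
Qed.

Lemma cost_column_le mu T : svrt_spec w T ->
  (\sum_j cost mu (rcol w j) (column T j) <= entry_sum mu T)%N.
Proof.
move=> sT; rewrite /entry_sum.
have -> : (\sum_(b in rothe w) \sum_(x in T b) mu x =
    \sum_j \sum_(i in rcol w j) \sum_(x in T (i, j)) mu x)%N.
  rewrite [RHS](exchange_big_dep xpredT) //= [RHS]pair_big_dep /=.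
  by apply: eq_big => [[i j]|[i j] _] //=; rewrite [RHS]inE.
apply: leq_sum => j _; apply: leq_sum => i Di.
by rewrite (bigD1 (column T j i)) ?column_in //= leq_addr.
Qed.

(** The column costs add up to at most [lowest], while each is at least its minimum; so each of them
    is minimal. *)
Lemma cost_column_min mu T j : svrt_spec w T -> (entry_sum mu T <= lowest w mu)%N ->
  (cost mu (rcol w j) (column T j) <= mincost mu (rcol w j))%N.
Proof.
move=> sT /(leq_trans (cost_column_le mu sT)).
rewrite /lowest (bigD1 j) //= [X in (_ <= X)%N](bigD1 j) //=.
move=> le_sum; rewrite -(leq_add2r (\sum_(k | k != j) mincost mu (rcol w k))).
apply: leq_trans le_sum; rewrite leq_add2l.
by apply: leq_sum => k _; apply/mincost_le/column_low_inj.
Qed.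

(** A tableau of order [lowest] would be cheapest in the columns [w d] and [w b], so
    [tier_unattained] gives a smaller entry in (c, w d) than in (c, w b), against the weak decrease
    of row c. *)
Lemma pattern_entry_sum (a c b d : 'I_n) T :
    (a < c)%N -> (c < b)%N -> (b < d)%N ->
    (w a < w d)%N -> (w d < w b)%N -> (w b < w c)%N -> svrt_spec w T ->
  (lowest w (tier_weight (rcol w (w b)) c) < entry_sum (tier_weight (rcol w (w b)) c) T)%N.
Proof.
move=> lt_ac lt_cb lt_bd w_ad w_db w_bc sT; rewrite ltnNge; apply/negP => min_T.
have colE i j : (i \in rcol w j) = (j < w i)%N && (i < (w^-1)%g j)%N by rewrite inE in_rothe.
have cDk : c \in rcol w (w b) by rewrite colE permK w_bc.
have bDj : b \in rcol w (w d) by rewrite colE permK w_db.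
have cDj : c \in rcol w (w d) by rewrite colE permK (ltn_trans w_db) //= (ltn_trans lt_cb).
have bDk : b \notin rcol w (w b) by rewrite colE ltnn.
have aDj : a \notin rcol w (w d) by rewrite colE ltnNge ltnW.
have sub : rcol w (w b) \subset rcol w (w d).
  apply/subsetP => i; rewrite !colE !permK => /andP[lt1 lt2].
  by rewrite (ltn_trans w_db) // (ltn_trans lt2).
have := tier_unattained lt_ac lt_cb bDj bDk cDk aDj sub
  (column_low_inj (w b) sT) (cost_column_min (w b) sT min_T)
  (column_low_inj (w d) sT) (cost_column_min (w d) sT min_T) (column_mono sT).
have [_ T2 _ _] := sT.
by rewrite ltnNge (T2 _ _ _ _ _ w_db (column_in sT cDk) (column_in sT cDj)).
Qed.

Lemma xeval_svrt_sum mu (k : nat) :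
    (forall T, svrt_spec w T -> (k <= entry_sum mu T)%N) ->
  exists q, xeval mu (tableau_formula w) = 'X^k * q.
Proof.
move=> le_k; rewrite /tableau_formula rmorph_sum; apply: (big_ind (fun p => exists q, p = 'X^k * q)).
- by exists 0; rewrite mulr0.
- by move=> _ _ [q1 ->] [q2 ->]; exists (q1 + q2); rewrite mulrDr.
move=> T /SVRTP sT; rewrite rmorphM rmorph_prod.
have -> : \prod_(b in rothe w) xeval mu (\prod_(t in T b)
    oplus (xvar t) (yvar n (rothe_m w b + b.1.+1 - t.+1)%N)) = 'X^(entry_sum mu T).
  rewrite expr_sum; apply: eq_bigr => b _.
  by rewrite rmorph_prod expr_sum; apply: eq_bigr => x _; exact: xeval_oplus.
exists ((xeval mu ((-1) ^+ (tableau_size w T - perm_length w))) * 'X^(entry_sum mu T - k)).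
by rewrite mulrCA -exprD subnKC // le_k.
Qed.

Lemma groth_formula_avoids : groth w = tableau_formula w -> avoids1432 w.
Proof.
move=> Ew [a [c [b [d [[lt_ac lt_cb lt_bd] [w_ad w_db w_bc]]]]]].
pose mu := tier_weight (rcol w (w b)) c.
have mu_gt0 i : (0 < mu i)%N by rewrite /mu /tier_weight addSn.
have := @groth_val _ w mu (@tier_weight_inj _ _ _) mu_gt0.
have [|q Eq] := @xeval_svrt_sum mu (lowest w mu).+1.
  by move=> T; apply: pattern_entry_sum lt_ac lt_cb lt_bd w_ad w_db w_bc.
(* Every term of the formula is divisible by X^(lowest + 1), so whatever the signs, cancelling
   leaves q2 divisible by X, against q2(0) <> 0. *)
rewrite Ew Eq => -[q1 [q2 [_ nz2]]]; rewrite exprSr mulrCA -mulrA.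
have nzX : 'X^(lowest w mu) != 0 :> {poly int} by rewrite expf_neq0 ?polyX_eq0.
by move/(mulfI nzX) => E; rewrite -E hornerM hornerX mul0r eqxx in nz2.
Qed.

End PatternTableaux.

Theorem theorem1p1 (n : nat) (n_ge1 : (1 <= n)%N) (w : 'S_n) :
  avoids1432 w <->
  groth w =
    \sum_(T in SVRT w (@flag0 n))
       (-1) ^+ (tableau_size w T - perm_length w)%N
       * \prod_(b in rothe w) \prod_(t in T b)
           oplus (xvar t) (yvar n (rothe_m w b + b.1.+1 - t.+1)%N).
Proof.
split; last exact: groth_formula_avoids.
by case: n n_ge1 w => // n _ w; exact: avoids_groth_formula.
Qed.
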